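(* Suppose $u$ and $v$ are admissible integers such that $v>2u$ and $u>13$. If there exists a TTS($u$) whose $2$-block intersection graph is bipartite, connected and non-Hamiltonian, then there exists a TTS($v$) whose $2$-block intersection graph is bipartite, connected and non-Hamiltonian.
   Context: A positive integer $v$ is admissible if $v\equiv 1$ or $3\pmod 6$. A twofold triple system of order $v$, TTS($v$), is a pair $(V,\mathcal{B})$ where $V$ is a set of $v$ points and $\mathcal{B}$ is a collection (repeated blocks allowed) of $3$-element subsets of $V$, called blocks, such that each $2$-element subset of $V$ is contained in precisely two blocks of $\mathcal{B}$. The $2$-block intersection graph ($2$-BIG) of $(V,\mathcal{B})$ is the graph whose vertices are the blocks of $\mathcal{B}$, where two blocks $B_1,B_2$ are adjacent if and only if $|B_1\cap B_2|=2$. A graph is Hamiltonian if it contains a Hamilton cycle. *)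

(* Defs.v *)
From mathcomp Require Import all_boot.

Set Implicit Arguments.
Unset Strict Implicit.
Unset Printing Implicit Defensive.

Definition admissible (v : nat) : bool :=
  (0 < v) && ((v == 1 %[mod 6]) || (v == 3 %[mod 6])).

(* The collection of blocks is a family indexed by a finite type, so that
   repeated blocks are distinct indices with the same image. *)
Record TTS (v : nat) := MkTTS {
  point : finType;
  block_index : finType;
  block : block_index -> {set point};
  card_point : #|point| = v;
  card_block : forall i : block_index, #|block i| = 3;
  pair_balance : forall P : {set point},
    #|P| = 2 -> #|[set i : block_index | P \subset block i]| = 2
}.

(* The vertices are the block indices, so the copies of a repeated block are
   different vertices, which are not adjacent since they meet in 3 points. *)
Definition two_BIG (v : nat) (D : TTS v) : rel (block_index D) :=
  [rel i j : block_index D | #|block i :&: block j| == 2].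

Arguments two_BIG {v} D i j.

Lemma two_BIG_sym (v : nat) (D : TTS v) : symmetric (two_BIG D).
Proof. by move=> i j; rewrite /two_BIG /= setIC. Qed.

Lemma two_BIG_irrefl (v : nat) (D : TTS v) : irreflexive (two_BIG D).
Proof. by move=> i; rewrite /two_BIG /= setIid card_block. Qed.

(* A graph is a symmetric irreflexive relation [e] on the finite type of its
   vertices; [A] and its complement are the two parts. *)
Definition bipartite (T : finType) (e : rel T) : Prop :=
  exists A : {set T}, forall x y : T, e x y -> (x \in A) != (y \in A).

Definition connected (T : finType) (e : rel T) : Prop :=
  0 < #|T| /\ forall x y : T, connect e x y.

(* [cycle] accepts [:: x; y] along a single edge, and [::]; the bound on the
   size excludes these. *)
Definition hamiltonian (T : finType) (e : rel T) : Prop :=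
  exists c : seq T,
    [/\ 2 < size c, cycle e c, uniq c & forall x : T, x \in c].

(* Main.v *)
From Stdlib Require Import Ascii String.
Require Import Defs.
From mathcomp Require Import all_boot ssralg zmodp zify.

(** Two disjoint Steiner triple systems on the same points form a twofold triple system
    whose 2-block intersection graph is cubic and bipartite: the two systems are the
    parts, and every pair of points is an edge, joining the two blocks that contain it
    ([bidesign_TTS]). The size conditions of the theorem give v >= 31, and for every
    admissible v >= 31 there are two such systems whose graph is connected and not
    Hamiltonian.

    A Hamilton cycle uses two of the three edges at every vertex of a cubic graph. It is
    therefore excluded by a configuration that forces all three edges at one vertex. The
    [fragment] is a family of 35 triples that only three edges leave; an exhaustive search
    shows that a Hamilton cycle avoiding one of these edges would contain a closed curve
    inside the fragment, so that this edge is forced ([fragment_used]). Three fragments on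
    22 points, placed around the block {0,1,2} of the first system so as to force its
    three edges, make the graph non-Hamiltonian ([gadget_nonhamiltonian]).

    It remains to embed this gadget into disjoint systems of every admissible order v >=
    31 with a connected graph ([rich]). For v < 63 there are explicit systems, verified by
    computation ([certified_rich]). Every larger order is 2u + 1 or 2u + 7 with a smaller
    admissible u >= 31, and is obtained by doubling ([rich_double], [rich_double_plus7]).
    To systems on a set V of u points one adds a set W of u + 1 or u + 7 points and
    matchings of W labelled by V: a point of V forms blocks with the edges that it labels.
    Pairs of W outside the matchings, which occur for 2u + 7, are covered by triples in W.
    The second system permutes the labels by a single cycle, which makes the two systems
    disjoint and links all pairs between V and W ([doubling_linked]).

    The blocks inside V still form a component of their own, and so do the triples inside
    W. A Pasch switch, which replaces blocks {x,y,z}, {x,P,Q}, {y,P,R}, {z,Q,R} by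
    {x,y,P}, {x,z,Q}, {y,z,R}, {P,Q,R}, is applied in the first system to attach each of
    them to the rest ([glue_bidesign]). The block in V is chosen with a point outside the
    gadget, so that the gadget survives ([glue_carries]). *)

Set Implicit Arguments.
Unset Strict Implicit.
Unset Printing Implicit Defensive.

(** * Pairs of Steiner systems and their block intersection graphs *)

(** A Steiner triple system as a Steiner quasigroup: [op a b] is the third point of the
    block through [a] and [b]. *)
Record steiner (P : Type) (op : P -> P -> P) : Prop := Steiner {
  opxx : forall a, op a a = a;
  opC : forall a b, op a b = op b a;
  opK : forall a b, op a (op a b) = b }.

(** Connectedness of the block intersection graph, in terms of its edges. A pair of points
    is the edge joining its two blocks, and two pairs inside one block are edges with a
    common end. *)
Definition linked (P : eqType) (op : bool -> P -> P -> P) : Prop :=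
  forall Q : P -> P -> Prop,
    (forall a b, Q a b -> Q b a) ->
    (forall k a b, Q a b -> Q a (op k a b)) ->
    forall a b c d, a != b -> c != d -> Q a b -> Q c d.

(** [op true] and [op false] are called the first and the second system. *)
Record bidesign (P : eqType) (op : bool -> P -> P -> P) : Prop := Bidesign {
  bd_steiner : forall k, steiner (op k);
  bd_disjoint : forall a b, a != b -> op true a b != op false a b;
  bd_linked : linked op }.

Section Steiner.
Variables (P : eqType) (op : P -> P -> P).
Hypothesis st : steiner op.

Lemma op_neq a b : a != b -> op a b != a.
Proof. by apply: contra => /eqP e; rewrite -(opK st a b) e (opxx st). Qed.

Lemma op_neqr a b : a != b -> op a b != b.
Proof. by rewrite (opC st) eq_sym; apply: op_neq. Qed.

Lemma opKr a b : op (op a b) b = a.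
Proof. by rewrite (opC st) (opC st a) (opK st). Qed.

Lemma block_perms u w z : op u w = z ->
  [/\ op w u = z, op u z = w, op z u = w & op w z = u /\ op z w = u].
Proof.
by move=> <-; rewrite (opC st w) !(opC st (op u w)) (opK st) -(opC st w) (opK st).
Qed.
End Steiner.

Section Design.
Variables (P : finType) (op : bool -> P -> P -> P).
Hypothesis bd : bidesign op.

Definition is_block (x : bool * {set P}) :=
  (#|x.2| == 3) && [forall a in x.2, forall b in x.2, op x.1 a b \in x.2].

Definition triple k a b : {set P} := [set a; b; op k a b].

Lemma triple_block k a b : a != b -> is_block (k, triple k a b).
Proof.
move=> ab; have st := bd_steiner bd k; rewrite /is_block /=; apply/andP; split.
  by rewrite /triple setUC cardsU1 cards2 !inE negb_or ab (op_neq st ab)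
    (op_neqr st ab).
suff H x y : x \in triple k a b -> y \in triple k a b -> op k x y \in triple k a b.
  by apply/forall_inP => x xT; apply/forall_inP => y yT; apply: H.
have C := opC st; have K := opK st; have Kr := opKr st; have I := opxx st.
rewrite /triple !inE => /orP [/orP [] /eqP -> | /eqP ->] /orP [/orP [] /eqP -> | /eqP ->];
  by rewrite ?I ?K ?Kr ?(C b a) ?(C (op k a b)) ?K ?(C a b) ?K ?eqxx ?orbT.
Qed.

Lemma block_triple k (B : {set P}) a b :
  is_block (k, B) -> a != b -> a \in B -> b \in B -> B = triple k a b.
Proof.
move=> /andP [/eqP cB /forall_inP H] ab aB bB; apply/eqP; rewrite eq_sym eqEcard.
have /andP [/eqP -> _] := triple_block k ab; rewrite cB leqnn andbT.
apply/subsetP => x; rewrite /triple !inE => /orP [/orP [] /eqP -> | /eqP ->] //.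
by have /forall_inP := H a aB; apply.
Qed.

Definition vertex : predArgType := {x : bool * {set P} | is_block x}.

Definition blk k a b (ab : a != b) : vertex := Sub (k, triple k a b) (triple_block k ab).

Lemma vertex_card (i : vertex) : #|(val i).2| = 3.
Proof. by case/andP: (valP i) => /eqP. Qed.

Lemma vertex_blk (i : vertex) a b (ab : a != b) :
  a \in (val i).2 -> b \in (val i).2 -> i = blk (val i).1 ab.
Proof.
move=> ai bi; apply: val_inj; case: i ai bi => [[k B] /= bB] ai bi.
by congr pair; apply: block_triple.
Qed.

Lemma vertex_balance (S : {set P}) :
  #|S| = 2 -> #|[set i : vertex | S \subset (val i).2]| = 2.
Proof.
move=> /eqP /cards2P [a [b [ab ->]]].
rewrite (_ : [set i | _] = [set blk true ab; blk false ab]).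
  by rewrite cards2 -(inj_eq val_inj).
apply/setP => i; rewrite !inE subUset !sub1set; apply/idP/idP.
  move=> /andP [ai bi]; rewrite (vertex_blk ab ai bi).
  by case: (val i).1; rewrite eqxx ?orbT.
by case/orP => /eqP -> /=; rewrite /triple !inE !eqxx orbT.
Qed.

Definition bidesign_TTS v (cP : #|P| = v) : TTS v :=
  MkTTS cP vertex_card vertex_balance.

Section Graph.
Variables (v : nat) (cP : #|P| = v).
Local Notation D := (bidesign_TTS cP).

(** Blocks of one system meeting in two points coincide, so adjacent blocks come from
    different systems; since the systems are disjoint, the two blocks on a pair meet in
    that pair only. *)
Lemma adjP (i j : vertex) : two_BIG D i j <->
  exists a b (ab : a != b), (i = blk (val i).1 ab) /\ (j = blk (~~ (val i).1) ab).
Proof.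
rewrite /two_BIG /= ; split.
  move=> /cards2P [a [b [ab e]]]; exists a, b, ab.
  have [[ai aj] [bi bj]] : ((a \in (val i).2) /\ (a \in (val j).2))
     /\ ((b \in (val i).2) /\ (b \in (val j).2)).
    by split; apply/andP; rewrite -in_setI e !inE eqxx ?orbT.
  have ei := vertex_blk ab ai bi; have ej := vertex_blk ab aj bj; split=> //.
  case: (boolP ((val j).1 == (val i).1)) => [/eqP eij | neq].
    have e2 : i = j by rewrite ei ej eij.
    by have := vertex_card j; rewrite -[(val j).2]setIid -{1}e2 e cards2 ab.
  by rewrite {1}ej; move: neq; case: (val j).1; case: (val i).1.
case=> a [b [ab [-> ->]]] /=; move: (val i).1 => k.
rewrite (_ : _ :&: _ = [set a; b]) ?cards2 ?ab //.
apply/setP => x; rewrite /triple !inE.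
case: (x == a) => //=; case: (x == b) => //=; apply/andP => -[/eqP -> /eqP e].
have := bd_disjoint bd ab; move: e; case: k => /= e.
  by rewrite e eqxx.
by rewrite -e eqxx.
Qed.

Lemma blk_adj k a b (ab : a != b) : two_BIG D (blk k ab) (blk (~~ k) ab).
Proof. by apply/adjP; exists a, b, ab. Qed.

Lemma bipartite_design : bipartite (two_BIG D).
Proof.
exists [set i : vertex | (val i).1] => i j /adjP [a [b [ab [-> ->]]]].
by rewrite !inE /=; case: (val i).1.
Qed.

Lemma blkC k a b (ab : a != b) (ba : b != a) : blk k ab = blk k ba.
Proof.
apply: val_inj => /=; congr pair; rewrite /triple.
by rewrite [op k b a](opC (bd_steiner bd k)) [[set a; b]]setUC.
Qed.

Lemma blk_op k a b (ab : a != b) (ac : a != op k a b) : blk k ab = blk k ac.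
Proof.
by apply: vertex_blk => /=; rewrite /triple !inE eqxx ?orbT.
Qed.

(** Reachability passes between the two blocks on a pair and between the pairs of one
    block: these are the steps of [linked]. *)
Lemma connected_design : 1 < v -> connected (two_BIG D).
Proof.
have gt1 : 1 < v -> 1 < #|P| by rewrite cP.
move=> /gt1 /card_gt1P [a0 [b0 [_ _ ab0]]].
set i0 : vertex := blk true ab0.
split; first by apply/card_gt0P; exists i0.
pose Q a b := forall k (ab : a != b), connect (two_BIG D) i0 (blk k ab).
have Qk k a b (ab : a != b) : connect (two_BIG D) i0 (blk k ab) -> Q a b.
  move=> h k' ab'; rewrite (bool_irrelevance ab' ab).
  case: (eqVneq k' k) => [-> // | kk'].
  have -> : k' = ~~ k by case: k k' kk' {h} => -[].
  by apply: connect_trans h (connect1 (blk_adj k ab)).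
have Q0 : Q a0 b0 by apply: (Qk true _ _ ab0); apply: connect0.
have QC a b : Q a b -> Q b a.
  move=> h k ba; have ab : a != b by rewrite eq_sym.
  by rewrite (blkC k ba ab).
have Qop k a b : Q a b -> Q a (op k a b).
  move=> h k' ac; have st := bd_steiner bd k.
  case: (eqVneq a b) => [e | ab]; first by exfalso; move: ac; rewrite e (opxx st) eqxx.
  by apply: (Qk k _ _ ac); rewrite -(blk_op ab ac).
have link (i : vertex) : connect (two_BIG D) i0 i.
  have /card_gt1P [a [b [ai bi ab]]] : 1 < #|(val i).2| by rewrite vertex_card.
  by rewrite (vertex_blk ab ai bi); apply: (bd_linked bd QC Qop ab0 ab Q0).
have sym : connect_sym (two_BIG D) by apply: sym_connect_sym; apply: two_BIG_sym.
by move=> i j; apply: connect_trans (link j); rewrite sym.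
Qed.

(** [U a b] says that the Hamilton cycle runs along the edge [a b]. It takes two of the
    three edges at each vertex of this cubic graph, and following it from any vertex
    reaches every vertex. *)
Lemma hamiltonian_used : hamiltonian (two_BIG D) ->
  exists U : rel P,
  [/\ symmetric U,
      forall k a b, a != b -> ~~ [&& U a b, U a (op k a b) & U b (op k a b)],
      forall k a b, a != b -> U a b || U a (op k a b)
    & forall Z : {set vertex}, Z != set0 ->
        (forall k a b (ab : a != b), blk k ab \in Z -> U a b ->
           blk (~~ k) ab \in Z) ->
        forall i, i \in Z].
Proof.
case=> c [c2 cyc uc call].
pose nx := next c; pose pv := prev c.
have pn i : pv (nx i) = i by apply: prev_next.
have np i : nx (pv i) = i by apply: next_prev.
have an i : two_BIG D i (nx i) by apply: next_cycle.
have ap i : two_BIG D i (pv i) by rewrite two_BIG_sym -{2}(np i); apply: an.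
(* A cycle on more than two vertices has distinct successor and predecessor. *)
have nxpv i : nx i != pv i.
  have [n c' ec] := rot_to (call i).
  rewrite /nx /pv -(next_rot n uc) -(prev_rot n uc) ec.
  have : 2 < size (i :: c') by rewrite -ec size_rot.
  have : uniq (i :: c') by rewrite -ec rot_uniq.
  case: c' {ec} => [|x [|y s]] // /and3P [ic xs _] _.
  have nextE : next (i :: x :: y :: s) i = x by rewrite /= eqxx.
  have prevE : prev (i :: x :: y :: s) i = last y s.
    by rewrite prev_nth mem_head memNindex // -(last_nth i i).
  by rewrite nextE prevE; apply/eqP => e; move: xs; rewrite {1}e mem_last.
pose U a b := [exists i : vertex,
  [&& a \in (val i).2, b \in (val i).2, a \in (val (nx i)).2 & b \in (val (nx i)).2]].
have nbr i j : two_BIG D i j -> (val j).1 = ~~ (val i).1.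
  by move/adjP => [a [b [ab [-> ->]]]].
have UE k a b (ab : a != b) :
    U a b <-> nx (blk k ab) = blk (~~ k) ab \/ pv (blk k ab) = blk (~~ k) ab.
  have mem k' x y (xy : x != y) : x \in (val (blk k' xy)).2 /\ y \in (val (blk k' xy)).2.
    by rewrite /= /triple !inE !eqxx orbT.
  split=> [/existsP [i /and4P [ai bi an' bn]] | ].
    have ei := vertex_blk ab ai bi; have en := vertex_blk ab an' bn.
    have ek := nbr _ _ (an i).
    case: (boolP ((val i).1 == k)) => [/eqP ik | ik].
      by left; rewrite -ik -ei -ek -en.
    have ik' : (val i).1 = ~~ k by move: ik; case: ((val i).1); case: (k).
    right; have -> : blk k ab = nx i by rewrite [in RHS]en ek ik' negbK.
    by rewrite pn -ik' -ei.
  case=> e.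
    apply/existsP; exists (blk k ab); rewrite e.
    by have [-> ->] := mem k a b ab; have [-> ->] := mem (~~ k) a b ab.
  apply/existsP; exists (blk (~~ k) ab); rewrite -e np e.
  by have [-> ->] := mem k a b ab; have [-> ->] := mem (~~ k) a b ab.
have UC : symmetric U.
  by move=> a b; apply/existsP/existsP => -[i /and4P [? ? ? ?]]; exists i; apply/and4P.
have third k a b (ab : a != b) : exists ac : a != op k a b, exists bc : b != op k a b,
    blk k ac = blk k ab /\ blk k bc = blk k ab.
  have st := bd_steiner bd k.
  have ac : a != op k a b by rewrite eq_sym (op_neq st).
  have bc : b != op k a b by rewrite eq_sym (op_neqr st).
  exists ac, bc; split; first by rewrite -(blk_op ab ac).
  by rewrite -(vertex_blk (i := blk k ab) bc) //= /triple !inE eqxx ?orbT.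
(* The three neighbours of a block are distinct, since one reached along two edges would
   have the same three points, against disjointness. *)
have nbrs k a b (ab : a != b) (ac : a != op k a b) (bc : b != op k a b) :
    [/\ blk (~~ k) ab != blk (~~ k) ac, blk (~~ k) ab != blk (~~ k) bc
      & blk (~~ k) ac != blk (~~ k) bc].
  have dj x y : x != y -> op (~~ k) x y = op k x y -> False.
    by move=> xy e; have := bd_disjoint bd xy; move: e; case: (k) => /= ->; rewrite eqxx.
  have ext x y z (xy : x != y) : z \in (val (blk (~~ k) xy)).2 -> z != x -> z != y ->
      z = op (~~ k) x y.
    by rewrite /= /triple !inE => /orP [/orP [] | ] /eqP -> //; rewrite eqxx.
  have st := bd_steiner bd k.
  have ca := ac; rewrite eq_sym in ca; have cb := bc; rewrite eq_sym in cb.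
  have ba := ab; rewrite eq_sym in ba.
  split; apply/eqP => e.
  - have : op k a b \in (val (blk (~~ k) ab)).2 by rewrite e /= /triple !inE eqxx orbT.
    by move=> /ext /(_ ca cb) /esym; apply: dj.
  - have : op k a b \in (val (blk (~~ k) ab)).2 by rewrite e /= /triple !inE eqxx orbT.
    by move=> /ext /(_ ca cb) /esym; apply: dj.
  - have : b \in (val (blk (~~ k) ac)).2 by rewrite e /= /triple !inE eqxx.
    move=> /ext /(_ ba bc) /esym; rewrite -{2}(opK st a b); exact: dj.
have cases i j k a b (ab : a != b) (ac : a != op k a b) (bc : b != op k a b) :
    i = blk k ab -> two_BIG D i j ->
    [\/ j = blk (~~ k) ab, j = blk (~~ k) ac | j = blk (~~ k) bc].
  move=> -> ij; have := ij; rewrite /two_BIG /= => /cards2P [x [y [xy e]]].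
  have jk := nbr _ _ ij; rewrite /= in jk.
  have [[xi xj] [yi yj]] : ((x \in triple k a b) /\ (x \in (val j).2))
     /\ ((y \in triple k a b) /\ (y \in (val j).2)).
    by split; apply/andP; rewrite -in_setI e !inE eqxx ?orbT.
  have ej u w (uw : u != w) : u \in (val j).2 -> w \in (val j).2 -> j = blk (~~ k) uw.
    by move=> uj wj; rewrite (vertex_blk uw uj wj) jk.
  move: xi yi xy xj yj {e}; rewrite /triple !inE.
  move=> /orP [/orP [] | ] /eqP -> /orP [/orP [] | ] /eqP -> xy xj yj;
    first [ by rewrite eqxx in xy | by constructor 1; apply: ej
          | by constructor 2; apply: ej | by constructor 3; apply: ej ].
exists U; split=> //.
- move=> k a b ab; have [ac [bc [eac ebc]]] := third k a b ab.
  apply/and3P => -[/(UE k _ _ ab) h1 /(UE k _ _ ac)]; rewrite eac => h2.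
  move=> /(UE k _ _ bc); rewrite ebc => h3.
  have [/eqP n1 /eqP n2 /eqP n3] := nbrs k a b ab ac bc.
  by case: h1 => e1; case: h2 => e2; case: h3 => e3; congruence.
- move=> k a b ab; have [ac [bc [eac ebc]]] := third k a b ab.
  have [e1|e1|e1] := cases _ _ k a b ab ac bc erefl (an (blk k ab)).
  + by apply/orP; left; apply/(UE k _ _ ab); left.
  + by apply/orP; right; apply/(UE k _ _ ac); left; rewrite eac.
  have [e2|e2|e2] := cases _ _ k a b ab ac bc erefl (ap (blk k ab)).
  + by apply/orP; left; apply/(UE k _ _ ab); right.
  + by apply/orP; right; apply/(UE k _ _ ac); right; rewrite eac.
  by have := nxpv (blk k ab); rewrite e1 e2 eqxx.
move=> Z /set0Pn [i0 i0Z] clo i.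
have nZ j : j \in Z -> nx j \in Z.
  move=> jZ; have /adjP [a [b [ab [ej en]]]] := an j.
  rewrite en; apply: clo; first by rewrite -ej.
  by apply/(UE (val j).1 _ _ ab); left; rewrite -ej.
have : fconnect nx i0 i by rewrite (fconnect_cycle (cycle_next uc)).
by move=> /iter_findex <-; elim: (findex _ _ _) => //= n; apply: nZ.
Qed.
End Graph.
End Design.

(** * A subgraph that forces an edge *)

Definition nat3 : Type := nat * nat * nat.

Definition pairs (t : nat3) : seq (nat * nat) :=
  let: (a, b, c) := t in [:: (a, b); (a, c); (b, c)].

(** Triples of the first and of the second system on the points 0, ..., 15. They cover the
    same pairs, except that {0,1}, {0,2} and {1,2} are covered by the second part only:
    these are the three edges leaving the subgraph. Closing it with one more triple
    {0,1,2} gives a cubic bipartite graph on 36 vertices, all of whose Hamilton cycles use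
    the edge {0,1}; it was found by a computer search for this property. *)
Definition fragment (k : bool) : seq nat3 :=
  if k then
    [:: (0,4,10); (1,3,4); (4,8,9); (3,9,10); (0,7,9); (5,8,10); (6,7,8);
        (3,5,7); (0,5,6); (1,14,15); (3,6,15); (3,13,14); (11,13,15);
        (6,12,14); (2,6,11); (2,12,13); (1,11,12)]
  else
    [:: (0,1,4); (0,2,6); (3,5,10); (5,6,8); (7,8,9); (3,4,9); (0,5,7);
        (3,6,7); (4,8,10); (0,9,10); (1,11,15); (2,11,13); (12,13,14);
        (1,3,14); (6,11,12); (1,2,12); (3,13,15); (6,14,15)].

(** A block has only one unused pair, so [p] cannot be added to the set [S] of unused
    pairs when a triple of the second part would then have two. *)
Definition clash (S : seq (nat * nat)) p :=
  has (fun t => (p \in pairs t) && has (fun q => (q != p) && (q \in S)) (pairs t))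
      (fragment false).

(** When [S] contains the unused pair of each triple, the used edges can be followed
    without choices; [k] and [p] are the system of the next triple and the pair through
    which it is entered. *)
Fixpoint strand n k p (S : seq (nat * nat)) : seq (bool * nat3) :=
  if n is n'.+1 then
    if [seq t <- fragment k | p \in pairs t] is t :: _ then
      if [seq q <- pairs t | (q != p) && (q \notin S)] is q :: _ then
        (k, t) :: strand n' (~~ k) q S
      else [:: (k, t)]
    else [::]
  else [::].

(** If the edge {0,1} is unused, the cycle visits the fragment once, entering through
    {0,2} and leaving through {1,2}. A triple off this strand then lies on a closed curve
    of used edges inside the fragment. The bound 36 exceeds the number of triples. *)
Definition rest S : seq (bool * nat3) :=
  let s := strand 36 false (0, 2) S in
  [seq x <- [seq (true, t) | t <- fragment true] ++ [seq (false, t) | t <- fragment false]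
    | x \notin s].

Definition isolated (S : seq (nat * nat)) (Z : seq (bool * nat3)) :=
  all (fun x => all (fun q => (q \in S) ||
         has (fun y => (y.1 == ~~ x.1) && (q \in pairs y.2)) Z) (pairs x.2)) Z.

Definition trapped S := let Z := rest S in ~~ nilp Z && isolated S Z.

(** Each triple in [ws] has an unused pair still to be chosen. Success means that every
    choice compatible with the second part traps a set of triples. *)
Fixpoint search (ws : seq nat3) (S : seq (nat * nat)) : bool :=
  if ws is t :: ws' then
    all (fun p => if clash S p then true else search ws' (p :: S)) (pairs t)
  else trapped S.

Lemma search_fragment : search (fragment true) [:: (0, 1)].
Proof. by vm_compute. Qed.

Definition obeys (P : Type) (op : bool -> P -> P -> P) k (phi : nat -> P) (t : nat3) :=
  let: (a, b, c) := t in op k (phi a) (phi b) = phi c.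

Section Fragment.
Variables (P : finType) (op : bool -> P -> P -> P).
Hypothesis bd : bidesign op.

(** What [hamiltonian_used] says of the edges of a Hamilton cycle. *)
Variable U : rel P.
Hypothesis UC : symmetric U.
Hypothesis Uall : forall k a b, a != b ->
  ~~ [&& U a b, U a (op k a b) & U b (op k a b)].
Hypothesis Uone : forall k a b, a != b -> U a b || U a (op k a b).
Hypothesis Uclosed : forall Z : {set vertex op}, Z != set0 ->
  (forall k a b (ab : a != b), blk bd k ab \in Z -> U a b -> blk bd (~~ k) ab \in Z) ->
  forall i, i \in Z.

Variable phi : nat -> P.
Hypothesis phiI : {in gtn 16 &, injective phi}.
Hypothesis phiB : forall k, {in fragment k, forall t, obeys op k phi t}.

Definition Uphi (p : nat * nat) := U (phi p.1) (phi p.2).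

(** The last clause says that the first block on {0,1} lies outside the fragment, so that
    the triples of the fragment are not all the blocks. *)
Lemma fragment_wf k t : t \in fragment k ->
  let: (a, b, c) := t in [&& a < b, b < c, c < 16 & ~~ (k && (a == 0) && (b == 1))].
Proof.
have : all (fun t : nat3 => let: (a, b, c) := t in
  [&& a < b, b < c, c < 16 & ~~ (k && (a == 0) && (b == 1))]) (fragment k) by case: k.
by move=> /allP /[apply].
Qed.

Lemma phi_neq a b : a < b -> b < 16 -> phi a != phi b.
Proof.
move=> ab b16; apply/eqP => e; move: (ab).
by rewrite (phiI _ _ e) ?ltnn // inE // (ltn_trans ab).
Qed.

Lemma fragment_op k a b c : (a, b, c) \in fragment k ->
  [/\ phi a != phi b, phi a != phi c, phi b != phi c &
   [/\ op k (phi a) (phi b) = phi c, op k (phi a) (phi c) = phi b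
     & op k (phi b) (phi c) = phi a]].
Proof.
move=> tk; have /and4P [ab bc c16 _] := fragment_wf tk.
have st := bd_steiner bd k; have e : op k (phi a) (phi b) = phi c := phiB tk.
have b16 := ltn_trans bc c16; have ac := ltn_trans ab bc.
rewrite (phi_neq ab b16) (phi_neq ac c16) (phi_neq bc c16); split=> //; split=> //.
  by rewrite -e (opK st).
by rewrite -e (opC st (phi a)) (opK st).
Qed.

Lemma fragment_has_unused k t : t \in fragment k -> has (fun p => ~~ Uphi p) (pairs t).
Proof.
case: t => [[a b] c] /fragment_op [ab _ _ [e _ _]].
have := Uall k ab; rewrite e /= /Uphi /=.
by case: (U _ _); case: (U _ _); case: (U _ _).
Qed.

Lemma fragment_one_unused k t p q :
  t \in fragment k -> p \in pairs t -> q \in pairs t -> q != p -> Uphi p || Uphi q.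
Proof.
case: t => [[a b] c] /fragment_op [ab ac bc [eab eac ebc]].
have st := bd_steiner bd k.
have h1 := Uone k ab; rewrite eab in h1.
have h2 := Uone k bc; rewrite ebc in h2.
have ca : phi c != phi a by rewrite eq_sym.
have h3 := Uone k ca; rewrite (opC st) eac in h3.
rewrite (UC (phi b) (phi a)) in h2.
rewrite (UC (phi c) (phi a)) (UC (phi c) (phi b)) in h3.
move=> pt qt; move: pt qt.
have -> : pairs (a, b, c) = [:: (a, b); (a, c); (b, c)] by [].
rewrite !in_cons !in_nil !orbF.
move=> /or3P [] /eqP -> /or3P [] /eqP ->; rewrite ?eqxx // /Uphi /= => _;
  first [ done | by rewrite orbC ].
Qed.

Lemma clash_used S p : (forall q, q \in S -> ~~ Uphi q) -> ~~ Uphi p -> ~~ clash S p.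
Proof.
move=> uS up; apply/hasPn => t tk; apply/negP => /andP [pt /hasP [q qt /andP [qp /uS uq]]].
by have := fragment_one_unused tk pt qt qp; rewrite (negbTE up) (negbTE uq).
Qed.

Definition img (x : bool * nat3) : bool * {set P} :=
  let: (k, (a, b, c)) := x in (k, [set phi a; phi b; phi c]).

Lemma img_blk k t a b (ab : phi a != phi b) : t \in fragment k -> (a, b) \in pairs t ->
  img (k, t) = val (blk bd k ab).
Proof.
case: t => [[x y] z] tk; have [xy xz yz [exy exz eyz]] := fragment_op tk.
have bk : is_block op (k, [set phi x; phi y; phi z]).
  by rewrite -exy; apply: triple_block.
have -> : pairs (x, y, z) = [:: (x, y); (x, z); (y, z)] by [].
rewrite !in_cons in_nil orbF => H; congr pair; apply: (block_triple bd) => //=;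
  by case/or3P: H => /eqP [ea eb]; subst a b; rewrite !inE eqxx ?orbT.
Qed.

Lemma rest_frag S x : x \in rest S -> x.2 \in fragment x.1.
Proof. by rewrite mem_filter mem_cat => /andP [_ /orP [] /mapP [t tk ->]]. Qed.

(** No used edge leaves [Z], so [Z] would contain every block; but the first block on
    {0,1} is not in the fragment. *)
Lemma isolated_false S Z : (forall q, q \in S -> ~~ Uphi q) ->
  {in Z, forall x, x.2 \in fragment x.1} -> ~~ nilp Z -> isolated S Z -> False.
Proof.
move=> uS Zf Z0 /allP iso.
pose ZZ := [set i : vertex op | val i \in [seq img x | x <- Z]].
have ZZ0 : ZZ != set0.
  case: Z Z0 Zf @ZZ {iso} => [|[k [[a b] c]] Z] // _ Zf ZZ.
  have tk := Zf _ (mem_head _ _); have [ab _ _ _] := fragment_op tk.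
  apply/set0Pn; exists (blk bd k ab); rewrite inE.
  by rewrite -(img_blk ab tk) ?map_f ?mem_head //= inE eqxx.
have clo k a b (ab : a != b) : blk bd k ab \in ZZ -> U a b -> blk bd (~~ k) ab \in ZZ.
  rewrite inE => /mapP [[k' [[x y] z]] xZ e] uab.
  have tk := Zf _ xZ; have /= ek : k = k' by case: e.
  subst k'; rewrite /= in tk; have [xy xz yz [exy exz eyz]] := fragment_op tk.
  have step p q (pq : phi p != phi q) : (p, q) \in pairs (x, y, z) -> U (phi p) (phi q) ->
      blk bd (~~ k) pq \in ZZ.
    move=> pt upq; have /allP /(_ _ pt) /orP [/uS | ] := iso _ xZ.
      by rewrite /Uphi upq.
    case/hasP => -[k2 t2] t2Z /andP [/= /eqP ek2 pt2]; subst k2.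
    rewrite inE -(img_blk pq (Zf _ t2Z) pt2); exact: map_f.
  have e2 : triple op k a b = [set phi x; phi y; phi z] by case: e.
  have mem3 u : u \in triple op k a b -> [\/ u = phi x, u = phi y | u = phi z].
    rewrite e2 !inE => /orP [/orP [] | ] /eqP ->;
      by [constructor 1 | constructor 2 | constructor 3].
  have [aT bT] : a \in triple op k a b /\ b \in triple op k a b.
    by rewrite /triple !inE !eqxx orbT.
  have inxy : (x, y) \in pairs (x, y, z) by rewrite /= !inE eqxx.
  have inxz : (x, z) \in pairs (x, y, z) by rewrite /= !inE eqxx orbT.
  have inyz : (y, z) \in pairs (x, y, z) by rewrite /= !inE eqxx !orbT.
  case: (mem3 _ aT) (mem3 _ bT) => ea [] eb; clear mem3 e e2 aT bT; subst a b;
  first [ by exfalso; rewrite eqxx in ab | exact: (step _ _ ab inxy uab)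
        | exact: (step _ _ ab inxz uab) | exact: (step _ _ ab inyz uab)
        | have ba := ab; rewrite eq_sym in ba; rewrite UC in uab;
          rewrite (blkC bd _ ab ba);
          first [ exact: (step _ _ ba inxy uab) | exact: (step _ _ ba inxz uab)
                | exact: (step _ _ ba inyz uab) ] ].
have ab : phi 0 != phi 1 by apply: phi_neq.
have := Uclosed ZZ0 clo (blk bd true ab); rewrite inE => /mapP [[k [[x y] z]] xZ [ek e]].
have tk := Zf _ xZ; subst k; rewrite /= in tk.
have /and4P [xy yz z16 n01] := fragment_wf (k := true) tk.
have m0 : phi 0 \in [set phi x; phi y; phi z] by rewrite -e !inE eqxx.
have m1 : phi 1 \in [set phi x; phi y; phi z] by rewrite -e !inE eqxx orbT.
have inj i j : i < 16 -> j < 16 -> (phi i == phi j) = (i == j).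
  by move=> i16 j16; apply/eqP/eqP => [/phiI -> // | -> //]; rewrite inE.
have y16 := ltn_trans yz z16; have x16 := ltn_trans xy y16.
move: m0 m1 n01 xy yz; rewrite !inE !inj //.
by clear; case: x => [|[|x]]; case: y => [|[|y]]; case: z => [|[|z]].
Qed.

Lemma search_false ws S : {subset ws <= fragment true} -> search ws S ->
  (forall q, q \in S -> ~~ Uphi q) -> False.
Proof.
elim: ws S => [|t ws IH] S sub /=.
  move=> /andP [Z0 iso] uS; apply: isolated_false uS _ Z0 iso.
  by move=> x; apply: rest_frag.
move=> /allP sr uS; have /hasP [p pt up] := fragment_has_unused (sub t (mem_head _ _)).
have := sr p pt; rewrite (negbTE (clash_used uS up)) => h; apply: IH h _.
  by move=> x xw; apply: sub; rewrite inE xw orbT.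
by move=> q; rewrite inE => /orP [/eqP -> // | /uS].
Qed.

(** The search, started with {0,1} among the unused pairs, traps a set of triples in every
    case. *)
Lemma fragment_used : U (phi 0) (phi 1).
Proof.
apply/negP => /negP u; apply: (search_false (fun _ => id) search_fragment).
by move=> q; rewrite inE => /eqP ->.
Qed.
End Fragment.

(** Three copies of the fragment on 22 points, whose forced edges {0,1}, {1,2} and {2,0}
    are the edges of a single block. *)
Definition frames : seq (seq nat) :=
  [:: [:: 0;1;8;13;20;9;14;19;18;17;11;3;7;15;5;4];
      [:: 1;2;9;15;11;12;6;18;5;21;19;10;4;16;17;14];
      [:: 2;0;5;7;18;19;20;6;8;13;16;10;3;17;21;12]].

Definition place (f : seq nat) (t : nat3) : nat3 :=
  let: (a, b, c) := t in (nth 0 f a, nth 0 f b, nth 0 f c).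

Definition gadget (k : bool) : seq nat3 :=
  (if k then [:: (0, 1, 2)] else [::]) ++
  flatten [seq [seq place f t | t <- fragment k] | f <- frames].

Lemma gadget_lt k a b c : (a, b, c) \in gadget k -> [&& a < 22, b < 22 & c < 22].
Proof.
have : all (fun t : nat3 => let: (x, y, z) := t in [&& x < 22, y < 22 & z < 22]) (gadget k).
  by case: k; vm_compute.
by move=> /allP /[apply].
Qed.

Definition carries (P : eqType) (op : bool -> P -> P -> P) (phi : nat -> P) :=
  {in gtn 22 &, injective phi} /\ forall k, {in gadget k, forall t, obeys op k phi t}.

(** The fragments force all three edges at the block {0,1,2} of the first system, whereas
    a Hamilton cycle uses only two. *)
Lemma gadget_nonhamiltonian (P : finType) (op : bool -> P -> P -> P)
    (bd : bidesign op) v (cP : #|P| = v) phi :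
  carries op phi -> ~ hamiltonian (two_BIG (bidesign_TTS bd cP)).
Proof.
case=> phiI phiG /hamiltonian_used [U [UC Uall Uone Uclosed]].
have used f : f \in frames -> U (phi (nth 0 f 0)) (phi (nth 0 f 1)).
  move=> fF; pose psi i := phi (nth 0 f i).
  have fP : [&& uniq f, size f == 16 & all (gtn 22) f].
    by move: f fF {psi}; apply/allP.
  case/and3P: fP => uf /eqP sf /allP f22.
  have psiI : {in gtn 16 &, injective psi}.
    move=> i j; rewrite !inE => i16 j16 /phiI e; apply/eqP.
    by rewrite -(nth_uniq 0 _ _ uf) ?sf //; apply/eqP/e; apply: f22; rewrite mem_nth ?sf.
  have psiB k : {in fragment k, forall t, obeys op k psi t}.
    move=> [[a b] c] tk; apply: (phiG k (place f (a, b, c))).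
    rewrite mem_cat; apply/orP; right; apply/flattenP.
    exists [seq place f t | t <- fragment k]; last exact: map_f tk.
    exact: (map_f (fun g => [seq place g t | t <- fragment k]) fF).
  exact: (fragment_used UC Uall Uone Uclosed psiI psiB).
have phi01 : phi 0 != phi 1 by apply/eqP => /phiI; rewrite !inE => /(_ isT isT).
have op01 : op true (phi 0) (phi 1) = phi 2 by apply: (phiG true (0, 1, 2)); rewrite mem_head.
have := Uall true _ _ phi01; rewrite op01 => /negP; apply.
rewrite (UC (phi 0) (phi 2)); apply/and3P; split.
- by apply: (used [:: 0;1;8;13;20;9;14;19;18;17;11;3;7;15;5;4]); rewrite !inE eqxx.
- by apply: (used [:: 2;0;5;7;18;19;20;6;8;13;16;10;3;17;21;12]); rewrite !inE eqxx !orbT.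
- by apply: (used [:: 1;2;9;15;11;12;6;18;5;21;19;10;4;16;17;14]); rewrite !inE eqxx !orbT.
Qed.

(** The invariant of the recursion on orders: a bidesign that extends another one inherits
    its gadget. *)
Definition rich v := exists (P : finType) (op : bool -> P -> P -> P) (phi : nat -> P),
  [/\ #|P| = v, bidesign op & carries op phi].

Lemma rich_TTS v : 1 < v -> rich v -> exists D : TTS v,
  [/\ bipartite (two_BIG D), connected (two_BIG D) & ~ hamiltonian (two_BIG D)].
Proof.
move=> v1 [P [op [phi [cP bd car]]]]; exists (bidesign_TTS bd cP); split.
- exact: bipartite_design.
- exact: connected_design.
- exact: gadget_nonhamiltonian car.
Qed.

(** * Explicit systems of small order *)

Lemma linked_root (P : eqType) (op : bool -> P -> P -> P) a0 b0 :
  (forall k, steiner (op k)) ->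
  (forall Q : P -> P -> Prop, (forall a b, Q a b -> Q b a) ->
     (forall k a b, Q a b -> Q a (op k a b)) ->
     Q a0 b0 -> forall a b, a != b -> Q a b) ->
  linked op.
Proof.
move=> st H Q QC Qop a b c d ab cd Qab.
(* The steps are reversible, so the equivalence with [Q a0 b0] propagates from pair to
   pair. *)
pose R x y := (Q a0 b0 -> Q x y) /\ (Q x y -> Q a0 b0).
have RH : forall x y, x != y -> R x y.
  apply: H => [x y [h1 h2] | k x y [h1 h2] | //].
    by split=> [/h1/QC // | /QC/h2].
  split=> [/h1/(Qop k) // | /(Qop k)]; rewrite (opK (st k)); exact: h2.
have [_ h1] := RH _ _ ab; have [h2 _] := RH _ _ cd.
exact: h2 (h1 Qab).
Qed.

Definition table := seq (seq nat).
Definition entry (t : table) a b := nth 0 (nth [::] t a) b.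
Definition put T (x0 : T) (t : seq (seq T)) a b c :=
  set_nth [::] t a (set_nth x0 (nth [::] t a) b c).

(** Points are written as consecutive characters, starting with the digit 0, of code 48. *)
Fixpoint codes (s : string) : seq nat :=
  if s is String c s' then nat_of_ascii c - 48 :: codes s' else [::].

(** The pairs are scanned in lexicographic order, and the next character completes a pair
    to a block only if no earlier block covers it; the entry [v] marks the pairs not yet
    covered. *)
Definition decode v (s : string) : table :=
  (foldl (fun (st : table * seq nat) (p : nat * nat) =>
     let: (t, cs) := st in let: (a, b) := p in
     if entry t a b < v then st else
     if cs is c :: cs' then
       (put 0 (put 0 (put 0 (put 0 (put 0 (put 0 t a b c) b a c) a c b) c a b) b c a) c b a, cs')
     else st)
   ([seq [seq if a == b then a else v | b <- iota 0 v] | a <- iota 0 v], codes s)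
   [seq (a, b) | a <- iota 0 v, b <- iota a.+1 (v - a.+1)]).1.

Definition steiner_table v t :=
  all (fun a => (entry t a a == a) && all (fun b =>
    let c := entry t a b in [&& c < v, entry t b a == c & entry t a c == b]) (iota 0 v))
    (iota 0 v).

Definition disjoint_tables v t1 t2 :=
  all (fun a => all (fun b => (a == b) || (entry t1 a b != entry t2 a b)) (iota 0 v)) (iota 0 v).

Definition carries_table k t :=
  all (fun x : nat3 => let: (a, b, c) := x in entry t a b == c) (gadget k).

Definition seen (m : seq (seq bool)) a b := nth false (nth [::] m a) b.

(** Graph search along the steps of [linked]: [w] is the stack of pairs to visit and [m]
    marks the visited ones. *)
Fixpoint explore n (t1 t2 : table) (w : seq (nat * nat)) m : seq (seq bool) :=
  if n is n'.+1 then
    if w is (a, b) :: w' then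
      if seen m a b then explore n' t1 t2 w' m else
      let c := entry t1 a b in let d := entry t2 a b in
      explore n' t1 t2 [:: (a, c), (b, c), (a, d), (b, d) & w']
        (put false (put false m a b true) b a true)
    else m
  else m.

(** A pair is expanded once and then pushes four pairs, so the search ends within the
    given number of steps. *)
Definition linked_tables v t1 t2 :=
  let m := explore (5 * v * v) t1 t2 [:: (0, 1)] [::] in
  all (fun a => all (fun b => (a == b) || seen m a b) (iota 0 v)) (iota 0 v).

Definition certified v s1 s2 :=
  let t1 := decode v s1 in let t2 := decode v s2 in
  [&& 22 <= v, steiner_table v t1, steiner_table v t2, disjoint_tables v t1 t2,
      carries_table true t1, carries_table false t2 & linked_tables v t1 t2].

Lemma seen_put m a b c x y :
  seen (put false m a b c) x y = if (x == a) && (y == b) then c else seen m x y.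
Proof.
rewrite /seen /put nth_set_nth /=; case: eqP => //= ->.
by rewrite nth_set_nth /=; case: eqP.
Qed.

Section Certified.
Variables (n : nat) (s1 s2 : string).
Local Notation v := n.+1.
Hypothesis cert : certified v s1 s2.
Let tab (k : bool) := if k then decode v s1 else decode v s2.
Let op (k : bool) (a b : 'I_v) : 'I_v := inord (entry (tab k) a b).

Lemma cert_steiner_table k : steiner_table v (tab k).
Proof. by case/and5P: cert => _ h1 h2 _ _; case: k. Qed.

Lemma cert_entry k (a b : 'I_v) : entry (tab k) a b = op k a b.
Proof.
have /allP /(_ a) := cert_steiner_table k; rewrite mem_iota ltn_ord => /(_ isT).
move=> /andP [_ /allP /(_ b)]; rewrite mem_iota ltn_ord => /(_ isT) /and3P [h _ _].
by rewrite inordK.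
Qed.

Lemma cert_steiner k : steiner (op k).
Proof.
have H (a b : 'I_v) : [/\ op k a a = a, op k b a = op k a b & op k a (op k a b) = b].
  have /allP /(_ a) := cert_steiner_table k; rewrite mem_iota ltn_ord => /(_ isT).
  move=> /andP [/eqP h1 /allP /(_ b)]; rewrite mem_iota ltn_ord => /(_ isT).
  move=> /and3P [_ /eqP h2 /eqP h3]; by split; apply: val_inj; rewrite /= -!cert_entry.
by split=> [a | a b | a b]; [case: (H a a) | case: (H b a) | case: (H a b)].
Qed.

(** Soundness is enough: a search stopped too early marks fewer pairs and fails the test. *)
Lemma explore_sound (Q : nat -> nat -> Prop) (t1 t2 : table) m0 w0 k0 :
  (forall a b, Q a b -> Q b a) ->
  (forall k a b, Q a b -> let c := entry (if k then t1 else t2) a b in Q a c /\ Q b c) ->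
  (forall a b, seen m0 a b -> Q a b) ->
  (forall p, p \in w0 -> Q p.1 p.2) ->
  forall a b, seen (explore k0 t1 t2 w0 m0) a b -> Q a b.
Proof.
move=> QC Qt; elim: k0 w0 m0 => [|k IH] //= [|[a b] w] m Qm Qw //.
have Qw' p : p \in w -> Q p.1 p.2 by move=> pw; apply: Qw; rewrite inE pw orbT.
have Qab : Q a b by apply: (Qw (a, b)); rewrite mem_head.
case: ifP => _; first exact: IH.
have [q1 q2] := Qt true _ _ Qab; have [q3 q4] := Qt false _ _ Qab.
apply: IH => [x y | p].
  rewrite !seen_put; case: andP => [[/eqP -> /eqP ->] _ | _]; first exact: QC Qab.
  by case: andP => [[/eqP -> /eqP ->] _ | _] //; apply: Qm.
rewrite !inE => /or4P [/eqP -> | /eqP -> | /eqP -> | /orP [/eqP -> | /Qw' //]] //=.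
Qed.

Lemma certified_rich : rich v.
Proof.
exists 'I_v, op, (fun i => inord i).
case/and5P: cert => v22 _ _ dj /and3P [c1 c2 lk].
have st := cert_steiner.
split; first by rewrite card_ord.
  split=> //.
    move=> a b ab; apply: contraTneq (allP (allP dj a _) b _); rewrite ?mem_iota ?ltn_ord //.
    by move=> e; rewrite (negbTE ab : (a == b :> nat) = false) /=
      (cert_entry true) (cert_entry false) e eqxx.
  pose x0 : 'I_v := inord 0; pose x1 : 'I_v := inord 1.
  apply: (linked_root (a0 := x0) (b0 := x1)) => // Q QC Qop Q0 a b ab.
  pose Q' x y := [/\ x < v, y < v & Q (inord x) (inord y)].
  have H : forall x y,
      seen (explore (5 * v * v) (tab true) (tab false) [:: (0, 1)] [::]) x y -> Q' x y.
    apply: explore_sound => [x y [? ? /QC] | k x y [xv yv qxy] | x y | p]; first by split.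
    + have -> : entry (if k then tab true else tab false) x y = op k (inord x) (inord y).
        by rewrite -cert_entry !inordK //; case: (k).
      split; split=> //; rewrite inord_val; first exact: Qop.
      by rewrite (opC (st k)); apply/Qop/QC.
    + by rewrite /seen nth_nil nth_nil.
    + by rewrite inE => /eqP -> /=; split=> //; apply: leq_trans v22.
  have := allP (allP lk a _) b _; rewrite !mem_iota !ltn_ord => /(_ isT isT).
  rewrite (negbTE ab : (a == b :> nat) = false) /= => /H [_ _].
  by rewrite !inord_val.
split.
  move=> i j; rewrite !inE => i22 j22 e; have := congr1 val e.
  by rewrite /= !inordK // (leq_trans _ v22).
move=> k [[a b] c] tk; rewrite /obeys; apply: val_inj.
have /and3P [a22 b22 c22] := gadget_lt tk.
rewrite /= -cert_entry !inordK ?(leq_trans _ v22) //.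
have ck : carries_table k (tab k) by case: (k).
by apply/eqP; move/allP: ck => /(_ _ tk).
Qed.
End Certified.

(** The systems of the eleven orders below were found by hill climbing, with the gadget
    prescribed on the points 0, ..., 21. *)
Lemma certified_31 : certified 31
  ("2:JGIBN>DEHKMCL75<AFMCDLHGEJNF:J=LMI?GABDKN?A;>L@NKJEMIAMG@LF>HKNIB>INDE" ++
   "C?LKMCD:?JFLKN?HFGD@EKN<KFBCHLBCMKJGNAI@JGHLIAHKMLNBJMMGKCMJIKAEFNLINHDM" ++
   "JLNJMNNIMHL")%string
  ("DB5FGE>C<AKNJLM;4=98IBNFMLEKJJ9DCKH>N@AIMLF>?KDMLHGEIN>:IL<?AGMKJN<?MJAC" ++
   "HEGLND=HABNMKLLNJABCHMFJKGBIDN@=MBDGHNGMKHLFIEFDNFJCIEKCDLNJ@HGLMJIMLKCK" ++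
   "MNNMLIHKJIN")%string.
Proof. by vm_compute. Qed.

Lemma certified_33 : certified 33
  ("2:KLJBH>DEIGOCPN75<NI?CDKPHEMJOF:8=NH?OABDJLPM?AN>G<PLJOEKMAJG@LP>NMIFOB" ++
   ">JDEC?KGMNPCD:P?IMLHO?FHKD@EPLOKLFJBCMPOBMCPOLNIAG@ONKJPAMHNOLGBFINOKNMC" ++
   "HIOPNAEFJKMOMGNDNKJPIMPLHILPOKPL")%string
  ("DB5FLE>C<AKIHONP;4=98PBMNKJEOLIP9DCKJ>G@AMHLOO>?JDGMHFENIL>:N;K?APGJILO<" ++
   "?ONACJEIPKMD=KABPGNMJMILABCPJOPFLBGDHMN@=IBKHGFOJMHLONKFIEMDNPOHCNEPCDPG" ++
   "NL@FLNOPOJMPLOICMPONKHOMLJMPPKNK")%string.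
Proof. by vm_compute. Qed.

Lemma certified_37 : certified 37
  ("2:8@JB>DEIRCOSLTQP75<LTKCDGQNFEJSPRM:I=PHO?TABDGRQSN?AK>JGPQOHLESNTAL@RH" ++
   ">NKISMJQTB>GLDEC?KNPSTRCD:S?MRGTLOQ?NFHD@EKTORSRTFQBCOPKSNBGCSMKIQPIAJ@M" ++
   "QOHNPSNAPKMOTMRBFJLSFOSPTRCLJHMOQTAEPLHOKTSTIQLRDPITQRSJTRMSPTRMQNSNQORT" ++
   "NQOPMR")%string
  ("DB5QFE>C<AHMLNOKST;4=98RBJITQENSMPOG9DCQS>R@AJKONMTJ>?RDNHPKEOMTLS>:PKIF" ++
   "?ALOTGJNS<?TGACQEHKSROPD=KABPNHTSRQKGFABCRSLTOIEMJBLDOPNR@=PBNJHMLSTSNFP" ++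
   "ILQMTLTEHDORQKGCOEQSTCDTSMJQR@ROPISNQSLTOQRMSGRNCMIKRPTQRSMTNJQPRTSIJOPQ" ++
   "RQPLTP")%string.
Proof. by vm_compute. Qed.

Lemma certified_39 : certified 39
  ("2:KRGBF>DEJNMCUQVPT75<IQMCDSPTVEKROLUK:F=HO<?ABDUNRSMQV?AI>FMHNUOTEJQRVA" ++
   "JT@RU>MOVHSPLQB>VLDEC?NSTJPUQCD:P?QRJMNTVU?SVQD@EGMTORURLHGBCKSUQPBCONUJ" ++
   "TVPMKAF@GSPIROTUOATSLINVQNBJMVLTSMKLTUSVCHLQOKVPUAEKHUTSRVGKVPORDIUJPSRT" ++
   "NLIQUVTRHNMVUSOSPNTRPQVTUVQSRSO")%string
  ("DB5RQE>C<AFOKVJNTSU;4=98VBLIFMEPKROUTG9DCVN>M@ALOTKPSUF>?UDLISVEKNROTQ>:" ++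
   "OVSQ?AUGPMHJTN<?IJACREVTUQSOPD=JABOKSIPVRUQIUABCNKLSPTMSTPBODJURQL@=GBKT" ++
   "NHLVSRRJTMKPQNOUVQEPDIONMHSCLERTOUCDGQUVNRT@IUPHKRTVHMUNQVSJNQMTUCKLPSUQ" ++
   "VTJVLSPRJSPRQTVGROUTVSRQVMUMVVS")%string.
Proof. by vm_compute. Qed.

Lemma certified_43 : certified 43
  ("2:LZKBO>DEXUHCWQMVYRT75<HGOCDTJNUEYZXVPSWO:Y=ZVW?JABDPGLXUSQT?AF>UPZVSIN" ++
   "EMYWTQXA;M@P>WSFRVOTQZXYB>TIDEC?JHUQWRPVXCD:T?VHJYPQRSZX?QPD@ENHJRMWUYXP" ++
   "WUNBCXLIRKYZBYCHVLMKTOSZVAS@LKUIXZRYNTGAFIXNSRYZWRHBFQVOXWUUJKNLTQWZCZNY" ++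
   "ORWXVSUAEGQVPWSRZYRYOLUZXWDPSQWONTZYRXSMYTUVZTLMPZYXRWJSMVTQXYZWSOVXSOVN" ++
   "TKUVZUUXZWYZY")%string
  ("DB5ZVE>C<AHNRMPYOQWUX;4=98?BIPJEVMOYXRZWUK9DCPN>W@ALUIMTQSYZP>?VDXTUYELS" ++
   "HJZOQW>:NWQS?ATLHFKPUYXV<?GUACVEZYNXWOPSTD=JABEOYSRZQXUWSQHABCJTMXRUZYT;" ++
   "UBZDKXRQLVPY@=FBIKWPXQRMZYZMGRTUWPOSVYRYEMDKLOPTVZOQCLEVZKYNXCDQRWXVNYST" ++
   "@PJWZVSUTOXFUXSRZQWYVOGNUQTZXCSOIPRTXYWYRJSUXVZWNWJMTRVXZQVKNUYXZHTWYSZX" ++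
   "LQSPTZWVZVWUY")%string.
Proof. by vm_compute. Qed.

Lemma certified_45 : certified 45
  ("2:FGYBP>DEOXQCMZKSTV\[75<VZICDFYR[E\LUOWQXTO:H=WYM?QABDPIRXUVZ[\?AP>WM@Y" ++
   "TUERN\L[XVZAS<@T>[HOUXKYPN\WZB>ILDEC?TJMVPXSY\[CD:Q?\NMUVTSW[RZ?HUID@EGM" ++
   "PXYQ[V\FLKBCSXMJ\ZWU[BPCNJQGURSX[\RAZ@OFSYPN\QVW[FASGOLWZVY\JVBIU[R\STXZ" ++
   "F[KWNURT\XCJ\WPQTZRUX[AELUTWMVZ[S\HLSVZNXWY[DWKTYUQXV\ZVXRNS\PUYZQZJL[P\" ++
   "XYWXY[\ZRVWUIWVS[RZZYO[T\SOQ[YOS\QTTYYWZXY")%string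
  ("DB5Y[E>C<AMFRUTPSV\OZX;4=98NBJUKTEMHZYWS\[X\9DCZH>U@AX[NMRWSPYV@>?LD<WEV" ++
   "QIRPZYSUX[>:TLKS?ARWZG\U[POVX<?PFACGERLUTXYZ[\WD=IABOYVJRUNTWX\VGSABCWN\" ++
   "XOPYR[W;JBNDQK[X\RVYZ@=OBZYMHTQN[\SXQJTRMHYS[VZW\TEPDVLW\ZQUX[\ICZETM[QX" ++
   "WVYCDTLZIKSYXU[@WVZSOXRQPY\IWKM[\QVYXFNSW[OTV\YCQIXOZV[U\WOPMSWL\U[ZPK\O" ++
   "MN[UYZXYLUT[RS\RUY\W[ZJXUQ\QZVNTTPZWVZTY\[")%string.
Proof. by vm_compute. Qed.

Lemma certified_49 : certified 49
  ("2:`ZWB_>DE\SNCX[]UOTR^VY75<\MNCDGYI]E_VZOXRW^[`S:J=UIP?WABDRVLZ`XT\]^_?A" ++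
   ";>^QU\`XEGP]VRMOW_[AK[@H\>SLWUZ^OPYXTV_B>KUDEC?RNMW^Y_TVX]`CD:?YOPUIL]\R" ++
   "`_VZ^?YLND@E\VTR]_^Z[`XWFR^BCYMOSQTZU`]B_CGRQT`JNXO\[]`A[@HRKVTPSUQZY]_I" ++
   "A_]KPU[QXT\Y^KRBZSHYUNV`][P^]YX`_WVTZSCY^HQTLOW\[ZX`AEJMVPNZX]`^[_G[JLUT" ++
   "`X_W^DLJ_[M\WQU^Z`Q\OZMWP[XY_^IWN[ZU^\`V_]T\M[V`]_^ZXWZXKN]S\`R][`SQY_QR" ++
   "[`_SY\\X^^Y_^`\S]`Y]_[Y]UZ_\\W^`")%string
  ("DB5_\E>C<AVFXQMZNY^]ST[`;4=98\B`[ZWEQKSJYUXRV_^^9DCPN>_@A]\`TWO[SRVZYZ>?" ++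
   "`DTP[NELGJUYVQ_SX]>:X<S?AJ\KH`N]OZ^YU[W<?IHACGEM\_WSYU^]Z[`D=]ABLVS_N`YW" ++
   "XT[U^T^VABC]HOSU[N_ZY`YJHB\DFPX_]Z[W^V`@=SBWX^MI[ZO\P]_VOZRYULWSQKV_X`]@" ++
   "LEDU^NXR[Q_`\UZCEYW[TQMR]^`\CDGPKLTYOW\X_`@QSOMX\[PTV_^]SVOX^]U\ZT`_UYK\" ++
   "[]^Q_`VWC_R]MUSZ`PT^[HOQZW^`[T]\_L^SKPWVRYZ_`VYL_PO[X]\`^RN`WXU_\ZRX^UL\" ++
   "]VWZY`R`_`\^TQ]X_\Y\W[\ZY]`^][^_")%string.
Proof. by vm_compute. Qed.

Lemma certified_51 : certified 51
  ("2:ITWBX>DER\QCHaN_O^[bY`]75<NKZCDFGXVEPQ^abYS\`[_Q:O=GI^?FABD[JWR\]Y_VXb" ++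
   "a?A^>GS@\TWE[R]VXbPZU`aAKJ@LY>MF\P^QOVT]Z_abB>LaDEC?F\KU_`YVXW^[bCD:]?ZQ" ++
   "PVIST[N\_a`b?[JaD@EQTbMXSUYW_`^EYGPBCRb]`U[aV_\^B`CX\LIVb_WZT]UYTAa@M[KL" ++
   "GWS`V]_X\bUAb\Z[XWPV_Q`^JWBRS_LZbaT^[]]NU^VOYX`bZW_CO_PU^[N\SVZYa`AES^`R" ++
   "Y]_PbWaZ[PM`LWObR][Va_DTQbZP^Na`W_Y]ROaYQZV\S^]b`SM`RPa_\XbZ]^Y[_a`R]^Zb" ++
   "WXOb\KXVTUY`aaVUW`]_NL]MZX_XZMTP\\ZUYa[S]`^TR[U[]^^a_Zb`b^\`\abba")%string
  ("DB5GbE>C<A]aO_Y^[VMQW`\XZ;4=98UBVFG_EaP\^QZT]bX`[S9DCL[>b@AVITZQ`UW^R_a]" ++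
   "G>?`Db[QZELXO^J\T_VUa]>:J`\H?AS[aRN]XT_QZVYb<?TOACMEKHZL^U[S\]Y`bD=OABYM" ++
   "QPVRL[T`Z\a_N\HABC[UKXZYS^]b_aVXLaBKDZHW\ON_^YUb@=LBJ[\USPWT_bY]a^Pb^QTW" ++
   "ZM_ON]RYa`S]EUDJaMZRW_X`^PNCREVJYWO\^_`]CD[^S\a`YOVUTX_@_T\bO`SUWY[Za^VI" ++
   "KSW]_`UZb[\]XaIWT[\b`_^CRN`UXP\Y]bV^aY_JRO]X^Wa`\bbYUSMQVZW\_`aWKTNPUR[X" ++
   "^ZbL]Q_KabS^`XP`]Z`R[^b[SX]Xb[a^Zb_Sba[`_a^a`PYVa\XT]_\W`]Y[b\bab")%string.
Proof. by vm_compute. Qed.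

Lemma certified_55 : certified 55
  ("2:UH_B\>DE^YVCPOKR]Sb[feacd75<9MCDNTYREWa[O]UP`Zbdc_fe:Q=FcX?WABDd[K_YfO" ++
   "TSb^\a`?AZ>bcfMXGFEJ\dQ^a]T`[Y_AaL@d^>KfPTXSZYOWcb][e`B>dIDEC?]KfMN\RUeX" ++
   "Z_bacCD:T?fO[^I\RWQS`Vcbed?OQND@E_YUb`TdZ\efX]cJUMBCZY`WO][XaT_VefBcCGLH" ++
   "RNfPVa[d\]Z`e`AY@FH]STXOdfeZb^\_cKAOWSPbQa^R_Y\ef`LB_RIdSebV]YZ\aQHURXbO" ++
   "W_]ac[feCZIMVWcabe[X^_\dfAEVPb_Z[X]cSe`dafF\R^NPQcZ`aUdeDY`][USNTXfdb^ce" ++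
   "_eL[P^Vab`Xc]fdMU`NXReYc\V[^adNaKU_YWcTbf]deeL_VNUf^`bcaZcdbV^\]f\Q]edca" ++
   "eQSc`f^VfWdZ[`e\^Wecf`_ZeTabcdVa[`_UZfW[_\^ddY_W^`^f]befa]fd`bb")%string
  ("DB5^UE>C<A_LZWbVdefcXR`\aY];4=98UBX]NdE\cSR_^TOYb`Zef\9DCYU>d@AVOZ_WML[c" ++
   "`X]fbeJ>?eDVYaLETOS[KPNXf^`b_d>:TeLI?AXWVMURNbQ`S]_\df<?XYACVENacePb\ZW^" ++
   "dT]`fD=HABKaYNVQPecX^f[]db[\dABCVIeWScX`ZUf]abZ;^BMD\]HYTVNcfR`dba@=SBNH" ++
   "M`GKafV_d\UXbcLV]HdXK^ZePfSTb_caRWEIDe\c_aY]QbZ[`f\_CbEaPZO`W[Q]fXeCDbPQ" ++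
   "`SfcROVWYd^e@KUcM^\[RaPVdebf`GMWOQdb_Ua\[cefR][TXUSadc\`_fC_Yb`[PTU]e^ca" ++
   "f\H_QVWZ\edR[af`cTUa\Nd^]eSY[`cfb\Je][^Y_`ZcafQefNSO_X[cY^fK`ZdX]^fWd]RO" ++
   "dT[YbUTZ_cY^dYeaX\]bV^aWVf`WZc_fdTYb_Z[a_a`b^ec_dbdef^ae^ceedce")%string.
Proof. by vm_compute. Qed.

Lemma certified_57 : certified 57
  ("2:fTLBF>DEGYcCah]UROV\dZg^be75<c]WCDNfH^E`_XeMhRSVZYdagP:Q=Z]g?_ABDHdOU`" ++
   "ba\fTVhe[c?Ab>[SO^KFfE]QcZ\TegWd`ahALX@KG>R_\YMPJUhd^W]cebgB>P`DEC?G\hNa" ++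
   "VMZXU[cegdfCD:F?dOVUSM[_cTaf\Zg`h?bIJD@EaWfTcPe]`gVd_\h\JeKBCbML^_TU`hYW" ++
   "gafBMCGYOeVNPUWQZT_dhfQAE@XhRcS\fdY`Ta]g^beLART`WVO[Y_cagdbhWHBZXe\aU^f[" ++
   "cYbdhYLOPN`f_Xgdb[cheCaU^Y[gd]fQhcVeZb`AEeLM]RPScU\[^baghN[_bS`hWRagef\^" ++
   "DWPedcQg[h`V\Xa]fHYKfbcdXWae`^\g_S^Y\VLUd[TeXh`bgTIVfcW]dgSX^`_hfbTQ^N`W" ++
   "]\a_hgJZReQg]bhZagX\h[dfgdR_`]bcaZQ`fYb^[_hXh]`gV[be_c^^_WXdg]Z\Y\bfaZbe" ++
   "g[_hc^deff`adehchfgcd]eff_ec")%string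
  ("DB5hWE>C<AMHQa_UbgP\^]e`Zfcd;4=98dB\OMKEYhbS]TQ`Xfagce__9DCKh>P@AQJ^\`MT" ++
   "S[gb]ZdefK>?^DGUQSEJWMYfN\TcXa`heg>:`Kcf?AYIJbPW_Q]e[^Zga\d<?cHACaEW][U\" ++
   "_fgdRY`Ve^hD=VAB_RgNJXU^`af[ehdcbf\OABCUYIRX_]c^Vhagbe_QXSBfDO\PRaMeV]^`" ++
   "Zgd@=ZBMgWdKXNebT[]Vh\ac^SF[VcKNhaZP]YWb`gfNKEdDSaRZYUWThef`gXYC`EGL]T^[" ++
   "eh_WdbgCDgfHPdbOZTWh^_]ec@TfOecZXhgbQUW`a^dY`VScgUZ[e_h]bafeV]Tf^hLWZg\c" ++
   "[bCVdMQ\cPW`bZ]^[ehR\^LM_QbTZdeg`fhZcS_TfOY]Xge\hbdbMQ\S`[a^Zdchgf^[`eLW" ++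
   "NX\U_haTd[X`hebQaRgVfXUe[ZdhgOWYcVOfYc`aYdf[`_hd^]\\hXaYedcScfhVcgbhd_ha" ++
   "U_cbgbfcab^fdYheg_fda`e]_gfg")%string.
Proof. by vm_compute. Qed.

Lemma certified_61 : certified 61
  ("2:dSfBU>DEMbZCKYVR_P\hjgkl`cai75<h\VCDOiNdEU[_lcg]`SRajYekf9:h=\M?GABDdc" ++
   "L[UaOb^jZek_flgi?AR>YUG_VfEkMTdj[g^ZiXc]bhlAlO@UT>ZWH[QkVjb_\icgha]efB>i" ++
   "MDEC?`HacgPekWYZ\f]_lbjCD:P?QKN\Sjkdg_Xbe[Zaicl?[eWD@Ea_JgdVc^Yh`fb]kji]" ++
   "lcjBCHGdeYSQa[k^bZ`gfBWCQLiFVXbfRYlgThkjedc\AQ@UdL`P]f^OhTbXjakgiclA^L[T" ++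
   "aXVkdRe]f_hjidhBYgZkMfXQcV^[`eaiHbN\lRaTcg^]ihjfkeCQU_`KWTkXea]dibfgjlAE" ++
   "G`WLRTaXgj_le[dkhfTJIgRe[df]WhbkljiDXh`eU]V[^aiWkglfjcRcY]`Lh[bWe^fXlgik" ++
   "ljgd[V_PZceUb]`^ki]ZKb^_\dlV`Y[egjk\gRfkeSYjhcai_lSi\ZjVf^hQJZibdXR^lfO]" ++
   "\Uh`ekljQU_aihahQl^ZbN]Xc^i`WSTjf^lhQikYjllZ`j`UifYkl[_g\hbfl`cW_dah\gi`" ++
   "dj\]leidc_ageegjdhdcbkbfhjdlkgkhkl")%string
  ("DB5GUE>C<AjX[]bcTNdfghWVl`eaik;4=98bBFS`fE]JM^YgRQid_ae\lkjf9DCN`>I@AGJg" ++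
   "cSk[ZR]elja^bihH>?cDj_WlET]QiSPY`XkUaebgdh>:PEkR?AgcUKIhbjfZ\^`]d[ial<?P" ++
   "^ACMEeSQNkWVjl[h`_d]figD=SABa[WeZQfX]d\bT`gkcilO\`ABCVkWUbRiY_g^hjflce\d" ++
   "ZVBNDhUS^g_cWQibYjkel@=PBjUHeiTXNMfd_[g]alkh_h[eXfRLlaZ`VQ^YWUgikQPEODlR" ++
   "^hiae[Tf\XdcgLSCNEf\[^Ue`ZYbidjklCDYMfXg_Q\eVc`k]a^dl@LMXVTfZ_]gh`e\kjil" ++
   "dVZ^fOcLbPUWgl`aeikJUjVZKh^bdiYkcefgCSQc_LVlYXbW`]kdhgjLH[YlPchSj_fi\]bd" ++
   "kI`RlegdhTUafi^j[_kXIT_ligj\kc]fdabhTNP`b^Wh]jdi_cglcY^dkg\`bd[hYbWgjlOM" ++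
   "i_jhdak]WlYbiekj\OXUWaj]djhk[kT]ZajliZSacg`V`bXZeja_fle\_jflXckief[gkea]" ++
   "chjlhfk\bil^Zhbhlgkdlehccf_hjfieji")%string.
Proof. by vm_compute. Qed.

(** * Pasch switches *)

Section Switch.
Variables (P : eqType) (op : P -> P -> P) (s : seq P).

(** A Pasch configuration consists of six points and four blocks, two through each point;
    each point misses exactly one other, its opposite. The list [s] is arranged so that
    positions [i] and [5 - i] are opposite. *)
Definition opp a := nth a s (5 - index a s).
Definition collinear a b := [&& a \in s, b \in s, a != b & b != opp a].
(** Replacing the third point by its opposite exchanges the blocks at positions 012, 034,
    135, 245 for 013, 024, 125, 345, which cover the same twelve pairs. *)
Definition switch a b := if collinear a b then opp (op a b) else op a b.

Definition pasch := [/\ uniq s, size s = 6 & forall x0,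
  [/\ op (nth x0 s 0) (nth x0 s 1) = nth x0 s 2, op (nth x0 s 0) (nth x0 s 3) = nth x0 s 4,
      op (nth x0 s 1) (nth x0 s 3) = nth x0 s 5 & op (nth x0 s 2) (nth x0 s 4) = nth x0 s 5]].

Hypothesis st : steiner op.
Hypothesis ps : pasch.

Lemma opp_nth x0 i : i < 6 -> opp (nth x0 s i) = nth x0 s (5 - i).
Proof.
case: ps => us sz _ i6; rewrite /opp index_uniq ?sz //.
by apply: set_nth_default; rewrite sz ltnS leq_subr.
Qed.

Lemma memP a : a \in s -> exists2 i, i < 6 & a = nth a s i.
Proof.
case: ps => _ sz _ sa; exists (index a s); first by rewrite -sz index_mem.
by rewrite nth_index.
Qed.

Lemma opp_mem a : a \in s -> opp a \in s.
Proof.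
case: (ps) => _ sz _ /memP [i i6 ->]; rewrite opp_nth //.
by rewrite mem_nth // sz ltnS leq_subr.
Qed.

Lemma oppK a : a \in s -> opp (opp a) = a.
Proof.
move=> /memP [i i6 ea]; rewrite ea !opp_nth ?ltnS ?leq_subr // subKn //.
Qed.

(** Replacing two points of a block of the configuration by their opposites gives another
    block of it. *)
Lemma pasch_op a b : collinear a b ->
  op a b \in s /\ op a (opp b) = opp (op a b).
Proof.
case: (ps) => us sz /(_ a) h /and4P [sa sb].
pose f := nth a s.
have [h1 h2 h3 h4] : [/\ op (f 0) (f 1) = f 2, op (f 0) (f 3) = f 4,
  op (f 1) (f 3) = f 5 & op (f 2) (f 4) = f 5] by exact: h.
have [h11 h12 h13 [h14 h15]] := block_perms st h1.
have [h21 h22 h23 [h24 h25]] := block_perms st h2.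
have [h31 h32 h33 [h34 h35]] := block_perms st h3.
have [h41 h42 h43 [h44 h45]] := block_perms st h4.
have hs := (h1, h11, h12, h13, h14, h15, h2, h21, h22, h23, h24, h25).
have ht := (h3, h31, h32, h33, h34, h35, h4, h41, h42, h43, h44, h45).
have fs i : i < 6 -> f i \in s by move=> i6; rewrite mem_nth ?sz.
have fo i : i < 6 -> opp (f i) = f (5 - i) by apply: opp_nth.
suff H i j : i < 6 -> j < 6 -> i != j -> j != 5 - i ->
    op (f i) (f j) \in s /\ op (f i) (f (5 - j)) = opp (op (f i) (f j)).
  have [i i6 ea] := memP sa; have [j j6] := memP sb.
  rewrite (set_nth_default a) ?sz // => eb ab nb.
  rewrite ea eb -!/(f _) fo //; apply: H => //.
    by apply: contraNneq ab => ij; rewrite ea eb ij.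
  by apply: contraNneq nb => ij; rewrite [X in opp X]ea eb ij -(opp_nth a i6).
case: i => [|[|[|[|[|[|i]]]]]] // _; case: j => [|[|[|[|[|[|j]]]]]] // _ _;
  rewrite ?subSS ?subn0 // => _; rewrite !(hs, ht) fo // ?subSS ?subn0; (split; [exact: fs | done]).
Qed.

Lemma collinearC a b : collinear a b = collinear b a.
Proof.
rewrite /collinear; case sa : (a \in s) => //; case sb : (b \in s) => //=.
rewrite [b == a]eq_sym; congr (_ && ~~ _); apply/eqP/eqP => ->; by rewrite oppK.
Qed.

Lemma collinear_op a b : collinear a b -> collinear a (op a b) /\ collinear a (opp (op a b)).
Proof.
move=> cab; have [so e] := pasch_op cab.
case/and4P: (cab) => sa sb ab nb.
have n1 : op a b != a by apply: op_neq.
have n2 : op a b != opp a.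
  apply/eqP => e2; move: e; rewrite e2 oppK // => e3.
  have e4 : opp b = a by rewrite -(opK st a (opp b)) e3 (opxx st).
  by move: nb; rewrite -e4 oppK // eqxx.
rewrite /collinear sa so opp_mem //=; split; apply/andP; split=> //.
- by rewrite eq_sym.
- by apply: contraNneq n2 => e4; rewrite [X in _ == opp X]e4 oppK.
- by apply: contraNneq n1 => e5; rewrite -[X in X == _](oppK so) e5 oppK.
Qed.

(** On the pairs of the configuration, [opp] commutes with [op a] in the sense of
    [pasch_op], so their composite is again an involution. *)
Lemma switch_steiner : steiner switch.
Proof.
split=> [a | a b | a b].
- by rewrite /switch /collinear eqxx /= !andbF (opxx st).
- by rewrite /switch collinearC (opC st).
rewrite {2}/switch; case: ifP => cab.
  have [c1 c2] := collinear_op cab; rewrite /switch c2.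
  have [so _] := pasch_op cab; have [_ ->] := pasch_op c1.
  by rewrite (opK st) !oppK //; case/and4P: cab.
rewrite /switch; case: ifP => c2; last by rewrite (opK st).
by have [] := collinear_op c2; rewrite (opK st) cab.
Qed.

Lemma switch_values x0 :
  [/\ switch (nth x0 s 0) (nth x0 s 1) = nth x0 s 3,
      switch (nth x0 s 0) (nth x0 s 2) = nth x0 s 4,
      switch (nth x0 s 1) (nth x0 s 2) = nth x0 s 5
    & switch (nth x0 s 3) (nth x0 s 4) = nth x0 s 5].
Proof.
case: (ps) => us sz /(_ x0) [h1 h2 h3 h4].
have col i j : i < 6 -> j < 6 -> i != j -> j != 5 - i ->
    collinear (nth x0 s i) (nth x0 s j).
  move=> i6 j6 ij nj; rewrite /collinear !mem_nth ?sz // opp_nth //.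
  by rewrite !nth_uniq ?sz ?ltnS ?leq_subr // ij nj.
have h5 : op (nth x0 s 0) (nth x0 s 2) = nth x0 s 1 by rewrite -h1 (opK st).
have h6 : op (nth x0 s 1) (nth x0 s 2) = nth x0 s 0.
  by rewrite -h1 (opC st (nth x0 s 0)) (opK st).
have h7 : op (nth x0 s 3) (nth x0 s 4) = nth x0 s 0.
  by rewrite -h2 (opC st (nth x0 s 0)) (opK st).
by rewrite /switch !col // h1 h5 h6 h7 !opp_nth.
Qed.

(** Only the four new blocks have to be compared with [op2], each through one of its
    pairs. *)
Lemma switch_disjoint (op2 : P -> P -> P) x0 : steiner op2 ->
  (forall a b, a != b -> op a b != op2 a b) ->
  op2 (nth x0 s 0) (nth x0 s 1) != nth x0 s 3 ->
  op2 (nth x0 s 0) (nth x0 s 2) != nth x0 s 4 ->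
  op2 (nth x0 s 1) (nth x0 s 2) != nth x0 s 5 ->
  op2 (nth x0 s 3) (nth x0 s 4) != nth x0 s 5 ->
  forall a b, a != b -> switch a b != op2 a b.
Proof.
move=> st2 dj n1 n2 n3 n4 a b ab.
case cab: (collinear a b); last by rewrite /switch cab; apply: dj.
case: (ps) => us sz _.
pose f := nth x0 s; rewrite -!/(f _) in n1 n2 n3 n4.
have [v1 v2 v3 v4] : [/\ switch (f 0) (f 1) = f 3, switch (f 0) (f 2) = f 4,
    switch (f 1) (f 2) = f 5 & switch (f 3) (f 4) = f 5] by exact: switch_values.
have [h11 h12 h13 [h14 h15]] := block_perms switch_steiner v1.
have [h21 h22 h23 [h24 h25]] := block_perms switch_steiner v2.
have [h31 h32 h33 [h34 h35]] := block_perms switch_steiner v3.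
have [h41 h42 h43 [h44 h45]] := block_perms switch_steiner v4.
have hs := (v1, h11, h12, h13, h14, h15, v2, h21, h22, h23, h24, h25).
have ht := (v3, h31, h32, h33, h34, h35, v4, h41, h42, h43, h44, h45).
move: cab; rewrite /collinear => /and4P [sa sb _].
have [i i6] := memP sa; have [j j6] := memP sb.
rewrite (set_nth_default x0) ?sz // => eb; rewrite (set_nth_default x0) ?sz // => ea.
rewrite ea eb opp_nth // in ab *; rewrite -!/(f _) in ab *.
move=> nb; apply/eqP => /esym e.
have [g1 g2 g3 [g4 g5]] := block_perms st2 e.
move: ab nb g1 g2 g3 g4 g5 e n1 n2 n3 n4; clear -i6 j6 hs ht.
case: i i6 => [|[|[|[|[|[|i]]]]]] // _; case: j j6 => [|[|[|[|[|[|j]]]]]] // _;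
  rewrite ?subSS ?subn0 ?eqxx // => _ _; rewrite !(hs, ht) => g1 g2 g3 g4 g5 e;
  by rewrite ?(e, g1, g2, g3, g4, g5) ?eqxx.
Qed.

Lemma switch_out a b : a \notin s -> switch a b = op a b.
Proof. by rewrite /switch /collinear => /negbTE ->. Qed.
End Switch.

(** * Doubling *)

Section Double.
Variables (V W : finType) (S : V -> V -> V) (f : V -> W -> W) (o : W -> W -> W).

(** A partial one-factorization of the complete graph on [W]: [f c] is the involution of
    the perfect matching with label [c], and two of these matchings share no edge. *)
Record factors : Prop := Factors {
  facK : forall c s, f c (f c s) = s;
  fac_neq : forall c s, f c s != s;
  fac_inj : forall c c' s, f c s = f c' s -> c = c' }.

Definition label s t := [pick c | f c s == t].

(** The pairs of [W] that lie in no matching are partitioned into triples; [o s t] is the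
    third point. *)
Record remainder : Prop := Remainder {
  remxx : forall s, o s s = s;
  remC : forall s t, label s t = None -> o s t = o t s;
  rem_label : forall s t, label s t = None -> label s (o s t) = None;
  remK : forall s t, label s t = None -> o s (o s t) = t }.

(** The blocks are those of [S], the sets {c, s, f c s}, and the triples of [o]. *)
Definition doubling (a b : V + W) : V + W :=
  match a, b with
  | inl a, inl b => inl (S a b)
  | inl a, inr s => inr (f a s)
  | inr s, inl a => inr (f a s)
  | inr s, inr t => if label s t is Some c then inl c else inr (o s t)
  end.

Hypotheses (st : steiner S) (ff : factors) (ro : remainder).

Lemma label_fac c s : label s (f c s) = Some c.
Proof.
rewrite /label; case: pickP => [c' /eqP /(fac_inj ff) -> // | /(_ c)].
by rewrite eqxx.
Qed.

Lemma labelP s t c : label s t = Some c -> f c s = t.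
Proof. by rewrite /label; case: pickP => // c' /eqP e [<-]. Qed.

Lemma labelC s t : label s t = label t s.
Proof. by apply: eq_pick => c /=; apply/eqP/eqP => <-; rewrite (facK ff). Qed.

Lemma labelxx s : label s s = None.
Proof. by rewrite /label; case: pickP => // c; rewrite (negbTE (fac_neq ff c s)). Qed.

Lemma doubling_steiner : steiner doubling.
Proof.
split=> [[a|s] | [a|s] [b|t] | [a|s] [b|t]] //=.
- by rewrite (opxx st).
- by rewrite labelxx (remxx ro).
- by rewrite (opC st).
- by rewrite labelC; case e: (label t s) => [c|] //; rewrite (remC ro e).
- by rewrite (opK st).
- by rewrite (facK ff).
- by rewrite label_fac.
- case e: (label s t) => [c|] /=; first by rewrite (labelP e).
  by rewrite (rem_label ro e) (remK ro e).
Qed.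
End Double.

(** * Linking the parts of a doubled design *)

(** The second system uses the labels permuted by a single cycle [p]; the first is a
    doubling changed at the few points [bad]. At a point [s] of [W] where nothing is
    changed, the blocks {c, s, f c s} of the first system and {d, s, f c s} of the second,
    with [p d = c], link the pairs [s c] and [s d]; running through the cycle, all pairs
    of [s] with points of [V] are linked. Pairs inside [V], and the pairs of [W] without a
    label, span closed subsystems of both unchanged doublings, and must be reached through
    the changes. *)
Section Link.
Variables (V W : finType) (S : bool -> V -> V -> V) (f : V -> W -> W) (p : V -> V)
          (o : bool -> W -> W -> W).
Hypothesis bdS : bidesign S.
Hypothesis ff : factors f.
Hypothesis pS : forall c, exists c', p c' = c.
Hypothesis pI : injective p.
Hypothesis p_cyc : forall R : V -> Prop, (forall c, R (p c) -> R c) -> forall c d, R c -> R d.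
Let f2 c := f (p c).

Lemma factors_shift : factors f2.
Proof.
by split=> [c s | c s | c c' s /(fac_inj ff)/pI //]; [apply: (facK ff) | apply: (fac_neq ff)].
Qed.

Lemma label_shift s t : (label f2 s t == None) = (label f s t == None).
Proof.
apply/eqP/eqP; rewrite /label; case: pickP => // H _; case: pickP => // c.
  by have [c' <-] := pS c; rewrite -/(f2 c') H.
by rewrite -/(f (p c)) H.
Qed.

Variable T : V + W -> V + W -> V + W.
Let T1 := doubling (S true) f (o true).
Let T2 := doubling (S false) f2 (o false).
Hypothesis stT : steiner T.
Hypothesis st2 : steiner T2.
Variable bad : pred W.
Hypothesis T_good : forall s x, ~~ bad s -> T (inr s) x = T1 (inr s) x.
Hypothesis good_path : forall s t, ~~ bad s -> ~~ bad t ->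
  exists2 r, ~~ bad r & label f s r != None /\ label f r t != None.
Hypothesis bad_good : forall s c, bad s -> ~~ bad (f c s) \/ ~~ bad (f (p c) s).
Variables (s0 : W) (c0 : V).
Hypothesis s0_good : ~~ bad s0.
Hypothesis T_old : forall a b, T (inl a) (inl b) = inl (S true a b) \/
  exists s, T (inl a) (inl b) = inr s.
Hypothesis T_hole : exists a b s, a != b /\ T (inl a) (inl b) = inr s.

(** The block of [T] on the unlabelled pair [s t] contains a point of [V] or a labelled
    pair, which links [s t] to the pairs between [V] and [W]. *)
Definition joined s t := (exists c, T (inr s) (inr t) = inl c) \/
  (exists2 w, T (inr s) (inr t) = inr w & label f s w != None \/ label f t w != None).

Hypothesis T_rem : forall s t, label f s t = None ->
  T (inr s) (inr t) = inr (o true s t) \/ joined s t.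
Hypothesis rem1 : remainder f (o true).
Hypothesis rem_link : forall R : W -> W -> Prop, (forall s t, R s t -> R t s) ->
  (forall k s t, label f s t = None -> R s t -> R s (o k s t)) ->
  (forall s t, label f s t = None -> joined s t -> R s t) ->
  forall s t, s != t -> label f s t = None -> R s t.

Lemma doubling_linked : linked (fun k => if k then T else T2).
Proof.
apply: (linked_root (a0 := inr s0) (b0 := inl c0)) => [[] // | Q QC Qop Q0].
have QT a b : Q a b -> Q a (T a b) := Qop true a b.
have Q2 a b : Q a b -> Q a (T2 a b) := Qop false a b.
(* One step around the cycle [p] at a good point. *)
have star s : ~~ bad s -> forall c d, Q (inr s) (inl c) -> Q (inr s) (inl d).
  move=> gs; apply: p_cyc => c /QT; rewrite T_good //= => /Q2 /=.
  by rewrite -/(f2 c s) (label_fac factors_shift).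
have good s : ~~ bad s -> forall c, Q (inr s) (inl c).
  have step x r : ~~ bad x -> ~~ bad r -> label f x r != None ->
      (forall c, Q (inr x) (inl c)) -> forall c, Q (inr r) (inl c).
    move=> gx gr; case e: (label f x r) => [d|] // _ Qx c; apply: (star r gr d).
    have := QC _ _ (QT _ _ (Qx d)); rewrite T_good //= (labelP e) => /QT.
    by rewrite T_good //= (labelC ff) // e.
  move=> gs; have [r gr [h1 h2]] := good_path s0_good gs.
  apply: (step r s) => //; apply: (step s0 r) => //.
  by move=> c; apply: (star s0) Q0.
(* At a bad point, the second point of [W] in one of the two blocks on [s c] is good. *)
have cross s c : Q (inr s) (inl c).
  case bs: (bad s); last by apply: good; rewrite bs.
  case: (bad_good c bs) => [g | g]; apply/QC.
    have := QT _ _ (QC _ _ (good _ g c)); rewrite (opC stT) T_good //=.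
    by rewrite (facK ff).
  have := Q2 _ _ (QC _ _ (good _ g c)); rewrite /=.
  by rewrite /f2 (facK ff).
have edge s t : label f s t != None -> Q (inr s) (inr t).
  rewrite -label_shift; case e: (label f2 s t) => [c|] // _.
  by have := Q2 _ _ (cross s c); rewrite /= (labelP e).
(* The hole is a block of [T] leaving [V]; from it the pairs inside [V] are linked as in
   [S], the changed blocks being holes themselves. *)
have old : forall a b, a != b -> Q (inl a) (inl b).
  pose R a b := Q (inl a) (inl b).
  have hole a b s : T (inl a) (inl b) = inr s -> R a b.
    move=> e; have := QT _ _ (QC _ _ (cross s a)).
    by rewrite -e (opK stT).
  have [a0 [b0 [s [ab0 /hole Rab]]]] := T_hole.
  move=> a b ab; apply: (bd_linked bdS (Q := R)) ab0 ab Rab => [x y | k x y Rxy].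
    exact: QC.
  case: k; last exact: Q2 Rxy.
  have [e | [w /hole //]] := T_old x (S true x y).
  have st1 := bd_steiner bdS true; rewrite (opK st1) in e.
  by rewrite /R -(opK stT (inl x) (inl (S true x y))) e; apply: QT.
have new s t : s != t -> Q (inr s) (inr t).
  move=> stn; case: (eqVneq (label f s t) None) => [e | ]; last exact: edge.
  pose R x y := Q (inr x) (inr y).
  have jR x y : joined x y -> R x y.
    case=> [[c e1] | [w e1 [l1 | l1]]].
    - by have := QT _ _ (cross x c); rewrite -e1 (opK stT).
    - by have := QT _ _ (edge _ _ l1); rewrite -e1 (opK stT).
    - have := QT _ _ (edge _ _ l1); rewrite -e1 (opC stT (inr x)) (opK stT).
      exact: QC.
  apply: (rem_link (R := R)) stn e => [x y | k x y e Rxy | x y _ //]; first exact: QC.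
    case: k; last first.
      have := Q2 _ _ Rxy; rewrite /=; have := label_shift x y; rewrite e eqxx.
      by move=> /eqP ->.
    have [e2 | /jR //] := T_rem (rem_label rem1 e).
    rewrite (remK rem1 e) in e2.
    by rewrite /R -(opK stT (inr x) (inr (o true x y))) e2; apply: QT.
  exact: jR.
move=> [a|s] [b|t] ab.
- by apply: old; apply: contraNneq ab => ->.
- exact/QC/cross.
- exact: cross.
- by apply: new; apply: contraNneq ab => ->.
Qed.
End Link.

(** [TB] is a first system already linked but for the pairs inside [V]. A Pasch switch on
    a block {x, y, z} of [V] and a triangle [P Q R] of [W] with labels [x], [y], [z]
    creates blocks {x, y, P}, {x, z, Q} and {y, z, R}, which leave [V]. *)
Section Glue.
Variables (V W : finType) (S : bool -> V -> V -> V) (f : V -> W -> W) (p : V -> V)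
          (o : bool -> W -> W -> W).
Hypothesis bdS : bidesign S.
Hypothesis ff : factors f.
Hypothesis pS : forall c, exists c', p c' = c.
Hypothesis pI : injective p.
Hypothesis p_cyc : forall R : V -> Prop, (forall c, R (p c) -> R c) -> forall c d, R c -> R d.
Hypothesis rem : forall k, remainder f (o k).

Let f2 c := f (p c).
Let T1 := doubling (S true) f (o true).
Let T2 := doubling (S false) f2 (o false).

Lemma remainder_shift : remainder f2 (o false).
Proof.
have E s t : label f2 s t = None <-> label f s t = None.
  by split=> h; apply/eqP; [rewrite -(label_shift f pS) | rewrite label_shift //]; rewrite -/f2 h.
have [h1 h2 h3 h4] := rem false.
by split=> // s t /E; [apply: h2 | move=> /h3/E | apply: h4].
Qed.

Lemma steiner2 : steiner T2.
Proof.
exact: doubling_steiner (bd_steiner bdS false) (factors_shift ff pI) remainder_shift.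
Qed.

Hypothesis p_neq : forall c, p c != c.
Hypothesis o_disj : forall s t, s != t -> label f s t = None -> o true s t != o false s t.

Lemma double_disjoint a b : a != b -> T1 a b != T2 a b.
Proof.
case: a b => [a|s] [b|t] ab.
- by apply: contraNneq (bd_disjoint bdS (_ : a != b)) => [[->] | ] //; apply: contraNneq ab => ->.
- rewrite /= /f2; apply/eqP => -[/(fac_inj ff) e].
  by have := p_neq a; rewrite -e eqxx.
- rewrite /= /f2; apply/eqP => -[/(fac_inj ff) e].
  by have := p_neq b; rewrite -e eqxx.
have stn : s != t by apply: contraNneq ab => ->.
rewrite /=; have := label_shift f pS s t; rewrite -/f2.
case e1: (label f s t) => [c|]; case e2: (label f2 s t) => [d|] // _.
  have h1 := labelP e1; have h2 := labelP e2; apply/eqP => -[cd].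
  have pd : p d = c by apply: (fac_inj ff (s := s)); rewrite h1 -h2.
  by have := p_neq d; rewrite pd cd eqxx.
by apply: contraNneq (o_disj stn e1) => -[->].
Qed.

Variables (TB : V + W -> V + W -> V + W) (bad : seq W).
Hypothesis stB : steiner TB.
Hypothesis TB_disj : forall a b, a != b -> TB a b != T2 a b.
Hypothesis TB_old : forall a b, TB (inl a) (inl b) = inl (S true a b).
Hypothesis TB_good : forall s x, s \notin bad -> TB (inr s) x = T1 (inr s) x.
Hypothesis TB_rem : forall s t, label f s t = None ->
  TB (inr s) (inr t) = inr (o true s t) \/ joined f TB s t.
Hypothesis rem_link : forall R : W -> W -> Prop, (forall s t, R s t -> R t s) ->
  (forall k s t, label f s t = None -> R s t -> R s (o k s t)) ->
  (forall s t, label f s t = None -> joined f TB s t -> R s t) ->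
  forall s t, s != t -> label f s t = None -> R s t.
Hypothesis good_path : forall s t, s \notin bad -> t \notin bad ->
  exists2 r, r \notin bad & label f s r != None /\ label f r t != None.
Hypothesis bad_good : forall s c, s \in bad -> f c s \notin bad \/ f (p c) s \notin bad.
Variable (s0 : W).
Hypothesis s0_good : s0 \notin bad.
Variables (x y z : V) (P Q R : W).
Hypothesis xy : x != y.
Hypothesis xyz : S true x y = z.
Hypothesis PQR : uniq [:: P; Q; R].
Hypothesis PQRbad : {subset [:: P; Q; R] <= bad}.
Hypothesis xPQ : TB (inl x) (inr P) = inr Q.
Hypothesis yPR : TB (inl y) (inr P) = inr R.
Hypothesis zQR : TB (inl z) (inr Q) = inr R.
Hypothesis edge : forall s t, s \in [:: P; Q; R] -> t \in [:: P; Q; R] -> s != t ->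
  label f s t != None.

Let six := [:: inl x; inl y; inl z; inr P; inr Q; inr R] : seq (V + W).
Let T := switch TB six.

Lemma glue_pasch : pasch TB six.
Proof.
have st1 := bd_steiner bdS true.
split=> [||a] //.
  have xz : x != z by rewrite -xyz eq_sym (op_neq st1).
  have yz : y != z by rewrite -xyz eq_sym (op_neqr st1).
  have injl : injective (@inl V W) by move=> a b [].
  have injr : injective (@inr V W) by move=> a b [].
  by rewrite /six /= !inE !(inj_eq injl) !(inj_eq injr) (negbTE xy) (negbTE xz) (negbTE yz)
    /=; move: PQR; rewrite /= !inE.
by rewrite /= TB_old xyz.
Qed.

Let stT : steiner T. Proof. exact: switch_steiner stB glue_pasch. Qed.

Lemma mem_six_inl a : (inl a \in six) = (a \in [:: x; y; z]).
Proof. by []. Qed.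

Lemma mem_six_inr s : (inr s \in six) = (s \in [:: P; Q; R]).
Proof. by []. Qed.

Lemma glue_old a b : T (inl a) (inl b) = inl (S true a b) \/
  [/\ a \in [:: x; y; z], b \in [:: x; y; z], a != b
    & exists s, T (inl a) (inl b) = inr s].
Proof.
rewrite /T /switch; case: ifP => cab; last by left.
have cab' := cab; have [so _] := pasch_op stB glue_pasch cab; right.
rewrite TB_old in so *; move: (so); rewrite mem_six_inl => so'.
case/and4P: cab; rewrite !mem_six_inl => ax bx ab _; split=> //.
have eN := opp_nth glue_pasch (inl x).
move: so'; rewrite !inE => /or3P [] /eqP ->.
- by exists R; rewrite (eN 0).
- by exists Q; rewrite (eN 1).
- by exists P; rewrite (eN 2).
Qed.

Lemma glue_rem s t : label f s t = None -> T (inr s) (inr t) = TB (inr s) (inr t).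
Proof.
move=> e; rewrite /T /switch; case: ifP => // /and4P [].
rewrite !mem_six_inr => sP tP st _.
have st' : s != t by apply: contraNneq st => ->.
by have := edge sP tP st'; rewrite e.
Qed.

Lemma glue_disjoint a b : a != b -> T a b != T2 a b.
Proof.
apply: (switch_disjoint stB glue_pasch (x0 := inl x) steiner2 TB_disj) => //=.
have PQ : P != Q by move: PQR; rewrite /= !inE negb_or -andbA => /and3P [].
have := edge (mem_head _ _) (_ : Q \in [:: P; Q; R]) PQ; rewrite !inE eqxx orbT => /(_ isT).
by rewrite -(label_shift f pS) -/f2; case: label.
Qed.

Theorem glue_bidesign : bidesign (fun k => if k then T else T2).
Proof.
split=> [[] | a b | ]; [exact: stT | exact: steiner2 | exact: glue_disjoint | ].
have jE s t : label f s t = None -> joined f T s t <-> joined f TB s t.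
  by move=> e; rewrite /joined glue_rem.
have [v1 _ _ _] := switch_values stB glue_pasch (inl x).
apply: (@doubling_linked V W S f p o bdS ff pS pI p_cyc T stT steiner2 (mem bad) _ _ _ s0 x) => //.
- move=> s a sb; rewrite -[RHS]/(T1 (inr s) a) -TB_good //; apply: switch_out.
  by rewrite mem_six_inr; apply: contra sb; apply: PQRbad.
- by move=> a b; case: (glue_old a b) => [-> | [_ _ _ h]]; [left | right].
- by exists x, y, P; split.
- move=> s t e; case: (TB_rem e) => [h | /jE h]; [left | right]; last exact: h.
  by rewrite glue_rem.
- move=> R0 RC Rop Rj; apply: rem_link => // s t e j; apply: Rj => //.
  exact/jE.
Qed.

(** The only block inside [V] that the switch destroys is {x, y, z}, and the gadget avoids
    [x]. *)
Lemma glue_carries phi : carries S phi -> (forall i, i < 22 -> phi i != x) ->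
  carries (fun k => if k then T else T2) (inl \o phi).
Proof.
case=> phiI phiG nx; split=> [i j i22 j22 [] | ]; first exact: phiI.
move=> k [[a b] c] tk; have e : S k (phi a) (phi b) = phi c := phiG k _ tk.
have lt : [&& a < 22, b < 22 & c < 22] := gadget_lt tk.
case/and3P: lt => a22 b22 c22.
rewrite /obeys; case: k tk e => tk e; last by rewrite /= e.
have st1 := bd_steiner bdS true.
have z1 : S true y z = x by rewrite -xyz (opC st1 x) (opK st1).
rewrite /= -e; case: (glue_old (phi a) (phi b)) => // -[].
rewrite !in_cons !in_nil !orbF (negbTE (nx a a22)) (negbTE (nx b b22)) /=.
move=> /orP [] /eqP ea /orP [] /eqP eb; rewrite ea eb ?eqxx // => _ _.
  by have := nx c c22; rewrite -e ea eb z1 eqxx.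
by have := nx c c22; rewrite -e ea eb (opC st1) z1 eqxx.
Qed.
End Glue.

(** * Choice of labels *)

Lemma seq_bij (T1 T2 : finType) (s : seq T1) (t : seq T2) :
  #|T1| = #|T2| -> uniq s -> uniq t -> size s = size t ->
  exists g : T1 -> T2, bijective g /\ map g s = t.
Proof.
move=> cT us ut st.
have full (T : finType) (r : seq T) : uniq r -> exists r', [/\ uniq (r ++ r'),
    forall x, x \in r ++ r' & size (r ++ r') = #|T|].
  move=> ur; exists [seq x <- enum T | x \notin r].
  have ua : uniq (r ++ [seq x <- enum T | x \notin r]).
    rewrite cat_uniq ur filter_uniq ?enum_uniq // andbT /=.
    by apply/hasPn => x; rewrite mem_filter => /andP [].
  have all x : x \in r ++ [seq x <- enum T | x \notin r].
    by rewrite mem_cat mem_filter mem_enum andbT orbN.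
  split=> //; rewrite cardE; apply/perm_size/uniq_perm => //; first exact: enum_uniq.
  by move=> x; rewrite mem_enum all.
have [s' [us' ss' zs]] := full _ _ us; have [t' [ut' tt' zt]] := full _ _ ut.
case: (pickP T2) => [y0 _ | T20]; last first.
  have e2 : #|T2| = 0 by apply: eq_card0.
  have no1 : T1 -> False.
    by move=> x; have := card0_eq (etrans cT e2) x; rewrite inE.
  have no2 : T2 -> False by move=> y; have := T20 y.
  exists (fun x => match no1 x with end); split.
    by exists (fun y => match no2 y with end) => x; [case: (no1 x) | case: (no2 x)].
  by case: s us st {us' ss' zs} => [|x]; [case: (t) | case: (no1 x)].
have [x0 _] : exists x0 : T1, true.
  have : 0 < #|T1| by rewrite cT; apply/card_gt0P; exists y0.
  by move=> /card_gt0P [x _]; exists x.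
pose g x := nth y0 (t ++ t') (index x (s ++ s')).
pose h y := nth x0 (s ++ s') (index y (t ++ t')).
have szE : size (s ++ s') = size (t ++ t') by rewrite zs zt.
exists g; split.
  exists h => [x | y]; rewrite /g /h index_uniq ?nth_index // -?szE ?index_mem //.
  by rewrite szE index_mem.
apply: (@eq_from_nth _ y0); rewrite size_map // => i si.
rewrite (nth_map x0) // /g index_cat mem_nth // index_uniq // nth_cat -st si //.
Qed.

(** The elements of [T] are arranged in a circle with those of [B] at the positions 0, 2,
    4, ..., so that no two of them are consecutive. *)
Lemma cyclic_perm (T : finType) (B : seq T) : uniq B -> 2 * size B <= #|T| -> 1 < #|T| ->
  exists p : T -> T, [/\ injective p, forall c, exists c', p c' = c,
    forall R : T -> Prop, (forall c, R (p c) -> R c) -> forall c d, R c -> R d,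
    forall c, p c != c & forall c, c \in B -> p c \notin B].
Proof.
move=> uB kB T1.
have [n nE] : exists n, #|T| = n.+2 by case: #|T| T1 => [|[|n]] // _; exists n.
pose t : seq 'I_n.+2 := [seq inord (2 * i) | i <- iota 0 (size B)].
have iv i : i < size B -> (inord (2 * i) : 'I_n.+2) = 2 * i :> nat.
  move=> iB; rewrite inordK //; rewrite nE in kB.
  by apply: leq_trans kB; rewrite ltn_mul2l.
have ut : uniq t.
  rewrite map_inj_in_uniq ?iota_uniq // => i j; rewrite !mem_iota !add0n => iB jB e.
  by have := congr1 val e; rewrite /= !iv // => /eqP; rewrite eqn_mul2l => /eqP.
have cT : #|T| = #|'I_n.+2| by rewrite card_ord.
have sz : size B = size t by rewrite size_map size_iota.
have [g [[h gh hg] gB]] := seq_bij cT uB ut sz.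
have memB c : c \in B -> exists2 i, i < size B & g c = 2 * i :> nat.
  move=> cB; have : g c \in t by rewrite -gB map_f.
  by move=> /mapP [i]; rewrite mem_iota add0n => /= iB ->; exists i; rewrite // iv.
pose p c := h (ordS (g c)).
have gp c : g (p c) = (g c).+1 %% n.+2 :> nat by rewrite /p hg.
exists p; split.
- by move=> c d /(can_inj hg)/ordS_inj/(can_inj gh).
- by move=> c; exists (h (ord_pred (g c))); rewrite /p hg ord_predK gh.
- move=> R RP c d Rc.
  have it m e : g (iter m p e) = (g e + m) %% n.+2 :> nat.
    elim: m => [|m IH]; first by rewrite addn0 modn_small.
    by rewrite iterS gp IH -addn1 modnDml -addnA addn1.
  have back m e : R (iter m p e) -> R e by elim: m => // m IH; rewrite iterS => /RP.
  apply: (back (g c + (n.+2 - g d))).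
  suff -> : iter (g c + (n.+2 - g d)) p d = c by [].
  apply: (can_inj gh); apply: val_inj; rewrite /= it addnCA subnKC; last exact: ltnW.
  by rewrite modnDr modn_small.
- move=> c; apply/eqP => e; have := gp c; rewrite e.
  have := ltn_ord (g c); rewrite ltnS leq_eqVlt => /orP [/eqP -> | l].
    by rewrite modnn.
  by rewrite modn_small // => /n_Sn.
- move=> c /memB [i iB gi]; apply/negP => /memB [j jB gj].
  move: gj; rewrite gp gi modn_small; last first.
    by rewrite -nE; apply: leq_trans kB; rewrite !mul2n -doubleS leq_double.
  by move=> /(congr1 odd); rewrite /= !mul2n !odd_double.
Qed.

(** The labels of the three edges of a triangle are distinct, so they can be renamed to
    the points of a given block. *)
Lemma relabel (V C W : finType) (f : C -> W -> W) (x y z : V) (P Q R : W) c1 c2 c3 :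
  factors f -> #|V| = #|C| -> uniq [:: x; y; z] -> uniq [:: P; Q; R] ->
  f c1 P = Q -> f c2 P = R -> f c3 Q = R ->
  exists g : V -> C, bijective g /\ [/\ g x = c1, g y = c2 & g z = c3].
Proof.
move=> ff cVC uV; rewrite /= !inE negb_or andbT => /andP [/andP [PQ PR] QR] e1 e2 e3.
have uC : uniq [:: c1; c2; c3].
  rewrite /= !inE negb_or andbT; apply/andP; split.
    apply/andP; split; apply/eqP => e.
      by move: QR; rewrite -e1 -e2 e eqxx.
    by move: PR; rewrite -e3 -e -e1 (facK ff) eqxx.
  by apply/eqP => e; move: PQ; rewrite -(facK ff c2 P) e2 -[Q](facK ff c3) e3 e eqxx.
have [g [gb gE]] := seq_bij cVC uV uC (erefl _).
by exists g; split=> //; case: gE.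
Qed.

Section Relabel.
Variables (V C W : finType) (f : C -> W -> W) (g : V -> C).
Hypothesis ff : factors f.
Hypothesis gb : bijective g.
Let f' v := f (g v).

Lemma factors_relabel : factors f'.
Proof.
split=> [c s | c s | c c' s e]; [exact: (facK ff) | exact: (fac_neq ff) | ].
exact: (bij_inj gb (fac_inj ff e)).
Qed.

Lemma label_relabel s t : (label f' s t == None) = (label f s t == None).
Proof.
case: gb => h gh hg; apply/eqP/eqP; rewrite /label; case: pickP => // H _; case: pickP => // c.
  by rewrite -(hg c) -/(f' (h c)) H.
by rewrite -/(f (g c)) H.
Qed.

Lemma remainder_relabel o : remainder f o -> remainder f' o.
Proof.
have E s t : label f' s t = None <-> label f s t = None.
  by split=> /eqP h; apply/eqP; [rewrite -label_relabel | rewrite label_relabel].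
case=> [h1 h2 h3 h4]; split=> // s t /E; [exact: h2 | by move=> /h3/E | exact: h4].
Qed.
End Relabel.

Lemma avoid (T : finType) (s : seq T) : size s < #|T| -> exists x, x \notin s.
Proof.
move=> h; have : ~~ ([set: T] \subset s).
  apply: contraL h => /subset_leq_card; rewrite cardsT -leqNgt => h.
  exact: leq_trans h (card_size _).
by move=> /subsetPn [x _ xs]; exists x.
Qed.

Lemma spare_block (V : finType) (S : bool -> V -> V -> V) phi :
  bidesign S -> 22 < #|V| -> exists x y z : V,
  [/\ uniq [:: x; y; z], S true x y = z & forall i, i < 22 -> phi i != x].
Proof.
move=> bd V22; have st := bd_steiner bd true.
have [x xN] : exists x, x \notin [seq phi i | i <- iota 0 22].
  by apply: avoid; rewrite size_map size_iota.
have [y] : exists y, y \notin [:: x] by apply: avoid; apply: leq_trans V22.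
rewrite inE eq_sym => xy; exists x, y, (S true x y); split=> //.
  rewrite /= !inE negb_or xy eq_sym (op_neq st xy) eq_sym.
  by rewrite (op_neqr st xy).
move=> i i22; apply: contraNneq xN => <-; apply: map_f.
by rewrite mem_iota.
Qed.

(** * Order 2u + 1 *)

Section RoundRobin.
Import GRing.Theory.
Local Open Scope ring_scope.
Variable n : nat.
Hypothesis n_even : ~~ odd n.
Local Notation Z := 'I_n.+1.

(* The inverse of 2 modulo the odd number n + 1. *)
Let h := (n./2).+1.

Lemma mulrn_order (c : Z) : c *+ n.+1 = 0.
Proof. by rewrite Zp_mulrn; apply: val_inj; rewrite /= modnMl. Qed.

Lemma halfK (c : Z) : c *+ 2 *+ h = c.
Proof.
rewrite -mulrnA mul2n /h doubleS.
have -> : (n./2).*2 = n by rewrite -[RHS]odd_double_half (negbTE n_even).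
by rewrite mulrS mulrn_order addr0.
Qed.

Lemma doubleK (c : Z) : c *+ h *+ 2 = c.
Proof. by rewrite mulrnAC halfK. Qed.

(** The round robin schedule on the integers modulo [n + 1] and a point [None] at
    infinity: in round [c], the players [a] and [b] with [a + b = c] meet, and the one
    with [2 a = c] meets [None]. *)
Definition round (c : Z) (w : option Z) : option Z :=
  if w is Some a then if c - a == a then None else Some (c - a) else Some (c *+ h).

Lemma round_factors : factors round.
Proof.
split=> [c [a|] | c [a|] | c d [a|]] //=.
- case: eqP => [e | ne] /=; first by rewrite -[c](subrK a) e -mulr2n halfK.
  by rewrite subKr; case: eqP => // e; case: ne; rewrite -e.
- by rewrite -{1}[c]doubleK mulr2n addrK eqxx.
- by case: (c - a =P a) => // ne; apply/eqP => -[].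
- case: (c - a =P a) => [e1 | n1]; case: (d - a =P a) => [e2 | n2] //.
    by rewrite -[c](subrK a) e1 -[d](subrK a) e2.
  by move=> /(congr1 (odflt 0)) /addIr.
- by move=> /(congr1 (odflt 0)) /= e; rewrite -[c]doubleK e doubleK.
Qed.

Lemma round_cover (s t : option Z) : s != t -> exists c, round c s = t.
Proof.
case: s t => [a|] [b|] // ab.
- exists (a + b); rewrite /= [a + b]addrC addrK; case: eqP => // e.
  by move: ab; rewrite e eqxx.
- by exists (a *+ 2); rewrite /= mulr2n addrK eqxx.
- by exists (b *+ 2); rewrite /= halfK.
Qed.
End RoundRobin.

(** The round robin schedule labels every pair of [W], so no triples inside [W] occur, and
    the single switch of [glue_bidesign] links the pairs inside [V] to the others. *)
Lemma rich_double u : odd u -> 22 < u -> rich u -> rich (2 * u + 1).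
Proof.
move=> ou u22 [V [S [phi [cV bdS car]]]].
have V22 : 22 < #|V| by rewrite cV.
have [x [y [z [uV xyz nx]]]] := spare_block phi bdS V22.
have [n nE] : exists n, u = n.+1 by case: (u) u22 => // n; exists n.
have n_even : ~~ odd n by move: ou; rewrite nE.
pose W : finType := option 'I_n.+1; pose f := @round n.
have ff : factors f := round_factors n_even.
pose P : W := None; pose Q : W := Some ord0; pose R : W := Some ord_max.
have n0 : 0 < n by move: u22; rewrite nE; case: (n).
have QR : Q != R by apply/eqP => -[e]; move: n0; rewrite -e.
have uW : uniq [:: P; Q; R] by rewrite /= !inE andbT.
have [c1 e1] : exists c, f c P = Q by apply: round_cover.
have [c2 e2] : exists c, f c P = R by apply: round_cover.
have [c3 e3] : exists c, f c Q = R by apply: round_cover.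
have cVC : #|V| = #|'I_n.+1| by rewrite card_ord cV.
have [g [gb [gx gy gz]]] := relabel ff cVC uV uW e1 e2 e3.
pose fV v := f (g v).
have ffV : factors fV := factors_relabel ff gb.
have [p [pI pS p_cyc p_neq p_sep]] : exists p : V -> V, [/\ injective p,
    forall c, exists c', p c' = c,
    forall R : V -> Prop, (forall c, R (p c) -> R c) -> forall c d, R c -> R d,
    forall c, p c != c & forall c, c \in [:: x; y; z] -> p c \notin [:: x; y; z]].
  by apply: cyclic_perm => //; rewrite cV; apply: leq_trans u22.
pose o (k : bool) (s t : W) := s.
have lab s t : label fV s t = None -> s = t.
  move=> /eqP; rewrite (label_relabel f gb); case: (eqVneq s t) => // st.
  have [c <-] := round_cover n_even st.
  by rewrite (label_fac ff).
have rem k : remainder fV (o k) by split=> // s t /lab // _; apply: labelxx.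
pose T1 := doubling (S true) fV (o true).
have st1 : steiner T1 := doubling_steiner (bd_steiner bdS true) ffV (rem true).
have o_disj s t : s != t -> label fV s t = None -> o true s t != o false s t.
  by move=> st /lab e; move: st; rewrite e eqxx.
have disj : forall a b, a != b -> T1 a b != doubling (S false) (fun c => fV (p c)) (o false) a b.
  exact: (double_disjoint bdS ffV pS p_neq o_disj).
(* The only labels inside the triangle are [x], [y] and [z], which [p] keeps apart. *)
have colour s t c : s \in [:: P; Q; R] -> t \in [:: P; Q; R] -> fV c s = t -> c \in [:: x; y; z].
  have fx : fV x P = Q by rewrite /fV gx.
  have fy : fV y P = R by rewrite /fV gy.
  have fz : fV z Q = R by rewrite /fV gz.
  have inj d a b : fV c a = b -> fV d a = b -> c = d by move=> <- h; rewrite (fac_inj ffV h).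
  have inj' d a b : fV c a = b -> fV d b = a -> c = d.
    by move=> <- h; apply: (inj d a (fV c a)); rewrite // -{1}h (facK ffV).
  rewrite !inE => /or3P [] /eqP -> /or3P [] /eqP -> e;
    first [ by have := fac_neq ffV c P; rewrite e eqxx
          | by have := fac_neq ffV c Q; rewrite e eqxx
          | by have := fac_neq ffV c R; rewrite e eqxx
          | by rewrite (inj _ _ _ e fx) eqxx | by rewrite (inj _ _ _ e fy) eqxx orbT
          | by rewrite (inj _ _ _ e fz) eqxx !orbT
          | by rewrite (inj' _ _ _ e fx) eqxx | by rewrite (inj' _ _ _ e fy) eqxx orbT
          | by rewrite (inj' _ _ _ e fz) eqxx !orbT ].
have cW : #|W| = u.+1 by rewrite card_option card_ord nE.
have [s0 s0N] : exists s0, s0 \notin [:: P; Q; R].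
  by apply: avoid; rewrite cW; apply: (@leq_trans 23) => //; apply: leqW.
have xy : x != y by move: uV; rewrite /= !inE negb_or -andbA => /and3P [].
have edge s t : s != t -> label fV s t != None.
  by move=> st; apply/eqP => /lab e; rewrite e eqxx in st.
pose TT := switch T1 [:: inl x; inl y; inl z; inr P; inr Q; inr R].
exists (V + W)%type,
  (fun k => if k then TT else doubling (S false) (fun c => fV (p c)) (o false)), (inl \o phi).
have fx : fV x P = Q by rewrite /fV gx.
have fy : fV y P = R by rewrite /fV gy.
have fz : fV z Q = R by rewrite /fV gz.
split; first by rewrite card_sum cV cW addnS addn1 mul2n addnn.
  apply: (@glue_bidesign V W S fV p o bdS ffV pS pI p_cyc rem T1 [:: P; Q; R] st1 disj
    _ _ _ _ _ _ s0) => //.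
  - by move=> s t e; left; rewrite /T1 /= e.
  - by move=> R0 _ _ _ s t st /lab e; rewrite e eqxx in st.
  - move=> s t sb tb; have [r] : exists r, r \notin [:: s; t; P; Q; R].
      by apply: avoid; rewrite cW; apply: (@leq_trans 23) => //; apply: leqW.
    rewrite !inE !negb_or => /and3P [rs rt rb]; exists r; first by rewrite !inE !negb_or.
    by split; apply: edge => //; rewrite eq_sym.
  - move=> s c sb; case b1: (fV c s \in [:: P; Q; R]); last by left.
    right; apply/negP => b2; have := p_sep c (colour _ _ _ sb b1 erefl).
    by rewrite (colour _ _ _ sb b2 erefl).
  - exact: (congr1 inr fx).
  - exact: (congr1 inr fy).
  - exact: (congr1 inr fz).
  - by move=> s t _ _; apply: edge.
by apply: glue_carries => //;
  [exact: (congr1 inr fx) | exact: (congr1 inr fy) | exact: (congr1 inr fz)].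
Qed.

(** * A circulant one-factorization without the differences 1, 2, 3 *)

Section Circulant.
Variable N : nat.

(** Arithmetic modulo [N] on numbers below [N], with a case distinction in place of a
    remainder so that linear arithmetic decides its properties. *)
Definition cadd a b := if a + b < N then a + b else a + b - N.
Definition csub a b := if b <= a then a - b else a + N - b.

(** The graph with edges from [a] to [a + e] modulo [N] is a union of cycles when [2 e <
    N]. The tint of such an edge alternates along a cycle, except that the edges passing
    over 0, which are never consecutive, receive a third tint. *)
Definition cycle_tint e a := if N - e <= a then 2 else nat_of_bool (odd (a %/ e)).

(** Among the two ends of the edges [s], [s + d] with [s] even and [d] odd, the even one. *)
Definition even_end d s := if odd s then csub s d else s.

Definition third a b := 3 - a - b.

Definition cross d s := if odd s then csub s d else cadd s d.

(** The matchings cover all differences except 0, 1, 2, 3 and their opposites. For odd [d]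
    up to [N / 2], the edges of even difference [d - 1] form cycles on the even points and
    cycles on the odd points, and the edges from even [s] to [s + d] join these two copies
    into prisms. The edges of a prism are coloured with three tints [i < 3]: both copies
    alike by [cycle_tint], and a cross edge by the tint missing at its two ends. For odd
    [d] above [N / 2] the cross edges alone are the matching [(d, 3)], and [(0, 4)]
    consists of the edges of difference [N / 2] when this is even. *)
Definition circ_factor (c : nat * nat) s :=
  let: (d, i) := c in
  if i == 3 then cross d s
  else if i == 4 then cadd s N./2
  else let s0 := even_end d s in
    if cycle_tint d.-1 s0 == i then cadd s d.-1
    else if cycle_tint d.-1 (csub s0 d.-1) == i then csub s d.-1
    else cross d s.

(** An explicit formula for the matching through [s] and [t]: it shows at once that the
    matchings are disjoint and which pairs they cover. *)
Definition circ_colour s t : nat * nat :=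
  let r := csub t s in
  if odd r then
    let d := if odd s then csub s t else r in
    if d.*2 <= N then
      (d, third (cycle_tint d.-1 (even_end d s)) (cycle_tint d.-1 (csub (even_end d s) d.-1)))
    else (d, 3)
  else if r.*2 < N then (r.+1, cycle_tint r (even_end r.+1 s))
  else if r.*2 == N then (0, 4)
  else let d := (N - r).+1 in (d, cycle_tint d.-1 (csub (even_end d s) d.-1)).

Definition valid_colour (c : nat * nat) :=
  let: (d, i) := c in
  [|| [&& i < 3, odd d, 5 <= d & d.*2 <= N],
      [&& i == 3, odd d, N < d.*2 & d + 5 <= N]
    | [&& i == 4, d == 0 & ~~ odd N./2]].

Hypothesis N_even : ~~ odd N.
Hypothesis N_big : 38 <= N.

Lemma caddE a b : a < N -> b < N -> cadd a b < N /\ (cadd a b = a + b \/ cadd a b + N = a + b).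
Proof. by rewrite /cadd; case: ifP => ? ? ?; lia. Qed.

Lemma csubE a b : a < N -> b < N -> csub a b < N /\ (csub a b + b = a \/ csub a b + b = a + N).
Proof. by rewrite /csub; case: ifP => ? ? ?; lia. Qed.

Lemma cycle_tint_add e a : 0 < e -> e.*2 < N -> a < N -> cycle_tint e (cadd a e) != cycle_tint e a.
Proof.
move=> e0 eN aN; rewrite /cycle_tint /cadd.
case: (ltnP (a + e) N) => h2; case: (leqP (N - e) a) => h1; try by lia.
  case: leqP => h3; first by case: odd.
  by rewrite divnDr ?divnn ?e0 // oddD; case: odd.
by rewrite leqNgt (_ : a + e - N < N - e) ?divn_small //=; lia.
Qed.

Lemma cycle_tint_lt3 e a : cycle_tint e a < 3.
Proof. by rewrite /cycle_tint; case: ifP => // _; case: odd. Qed.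

Lemma caddK a b : a < N -> b < N -> csub (cadd a b) b = a.
Proof.
by move=> aN bN; have [cN] := caddE aN bN; have [] := csubE cN bN; lia.
Qed.

Lemma csubK a b : a < N -> b < N -> cadd (csub a b) b = a.
Proof.
by move=> aN bN; have [cN] := csubE aN bN; have [] := caddE cN bN; lia.
Qed.

Lemma cadd_lt a b : a < N -> b < N -> cadd a b < N.
Proof. by move=> aN bN; have [] := caddE aN bN. Qed.

Lemma csub_lt a b : a < N -> b < N -> csub a b < N.
Proof. by move=> aN bN; have [] := csubE aN bN. Qed.

Lemma codd_add a b : a < N -> b < N -> odd (cadd a b) = odd a (+) odd b.
Proof. by move=> aN bN; have [_] := caddE aN bN; lia. Qed.

Lemma codd_sub a b : a < N -> b < N -> odd (csub a b) = odd a (+) odd b.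
Proof. by move=> aN bN; have [_] := csubE aN bN; lia. Qed.

Lemma cadd_csubC a b c : a < N -> b < N -> c < N -> csub (cadd a b) c = cadd (csub a c) b.
Proof.
move=> aN bN cN; have [] := caddE aN bN; have [] := csubE aN cN.
move=> h1 h2 h3 h4; have [] := csubE h3 cN; have [] := caddE h1 bN; lia.
Qed.

Lemma csubAC a b c : a < N -> b < N -> c < N -> csub (csub a b) c = csub (csub a c) b.
Proof.
move=> aN bN cN; have [] := csubE aN bN; have [] := csubE aN cN.
move=> h1 h2 h3 h4; have [] := csubE h3 cN; have [] := csubE h1 bN; lia.
Qed.

Lemma even_end_lt d s : s < N -> d < N -> even_end d s < N.
Proof. by rewrite /even_end => sN dN; case: ifP => // _; apply: csub_lt. Qed.

Lemma even_end_add d e s : s < N -> d < N -> e < N -> ~~ odd e ->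
  even_end d (cadd s e) = cadd (even_end d s) e.
Proof.
move=> sN dN eN ee; rewrite /even_end codd_add // (negbTE ee) addbF.
by case: ifP => // _; apply: cadd_csubC.
Qed.

Lemma even_end_sub d e s : s < N -> d < N -> e < N -> ~~ odd e ->
  even_end d (csub s e) = csub (even_end d s) e.
Proof.
move=> sN dN eN ee; rewrite /even_end codd_sub // (negbTE ee) addbF.
by case: ifP => // _; apply: csubAC.
Qed.

Lemma cadd_sub s e : s < N -> e < N -> csub (cadd s e) s = e.
Proof.
by move=> sN eN; have [cN] := caddE sN eN; have [] := csubE cN sN; lia.
Qed.

Lemma csub_sub s e : s < N -> 0 < e -> e < N -> csub (csub s e) s = N - e.
Proof.
by move=> sN e0 eN; have [cN] := csubE sN eN; have [] := csubE cN sN; lia.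
Qed.

Lemma csubKC s e : s < N -> e < N -> csub s (csub s e) = e.
Proof.
by move=> sN eN; have [cN] := csubE sN eN; have [] := csubE sN cN; lia.
Qed.

Lemma cross_lt d s : s < N -> d < N -> cross d s < N.
Proof. by rewrite /cross => sN dN; case: ifP => _; [apply: csub_lt | apply: cadd_lt]. Qed.

Lemma odd_cross d s : s < N -> d < N -> odd d -> odd (cross d s) = ~~ odd s.
Proof.
move=> sN dN od; rewrite /cross; case os: (odd s); first by rewrite codd_sub // os od.
by rewrite codd_add // os od.
Qed.

Lemma crossK d s : s < N -> d < N -> odd d -> cross d (cross d s) = s.
Proof.
move=> sN dN od; rewrite {1}/cross odd_cross // /cross; case: (odd s) => /=.
  exact: csubK.
exact: caddK.
Qed.

Lemma even_end_cross d s : s < N -> d < N -> odd d -> even_end d (cross d s) = even_end d s.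
Proof.
move=> sN dN od; rewrite /even_end odd_cross // /cross.
by case: (odd s) => //=; apply: caddK.
Qed.

Lemma circ_factor_prism d i s : i < 3 -> circ_factor (d, i) s =
  if cycle_tint d.-1 (even_end d s) == i then cadd s d.-1
  else if cycle_tint d.-1 (csub (even_end d s) d.-1) == i then csub s d.-1 else cross d s.
Proof. by case: i => [|[|[|i]]]. Qed.

Lemma cycle_tint_sub e a : 0 < e -> e.*2 < N -> a < N -> cycle_tint e (csub a e) != cycle_tint e a.
Proof.
move=> e0 eN aN; have eN' : e < N by lia.
by rewrite eq_sym -{1}(csubK aN eN'); apply: cycle_tint_add => //; apply: csub_lt.
Qed.

Lemma circ_factor_spec c s : valid_colour c -> s < N ->
  [/\ circ_factor c s < N, circ_factor c (circ_factor c s) = s, circ_factor c s != s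
    & circ_colour s (circ_factor c s) = c].
Proof.
case: c => d i /or3P
  [/and4P [i3 od d5 dN] | /and4P [/eqP -> od dN d5] | /and3P [/eqP -> /eqP -> oN]] sN.
- have dN' : d < N by lia.
  have e0 : 0 < d.-1 by lia.
  have eN : d.-1.*2 < N by lia.
  have eN' : d.-1 < N by lia.
  have ee : ~~ odd d.-1 by lia.
  have s0N := even_end_lt sN dN'.
  rewrite !circ_factor_prism //.
  case: eqP => h1.
    have tN := cadd_lt sN eN'.
    split=> //.
    + rewrite even_end_add //; have := cycle_tint_add e0 eN s0N; rewrite h1 => /negbTE ->.
      by rewrite caddK // h1 eqxx caddK.
    + by have [_] := caddE sN eN'; lia.
    + have r := cadd_sub sN eN'.
      by rewrite /circ_colour r (negbTE ee) eN prednK ?h1 //; lia.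
  case: eqP => h2.
    have tN := csub_lt sN eN'.
    split=> //.
    + rewrite even_end_sub // h2 eqxx; exact: csubK.
    + by have [_] := csubE sN eN'; lia.
    + have r := csub_sub sN e0 eN'.
      have orN : odd (N - d.-1) = false by lia.
      rewrite /circ_colour r orN ifF; last by lia.
      rewrite ifF; last by lia.
      have -> : (N - (N - d.-1)).+1 = d by lia.
      by rewrite /= h2.
  have tN := cross_lt sN dN'.
  split=> //.
  + by rewrite even_end_cross //; case: eqP => //; case: eqP => // _ _; apply: crossK.
  + by apply/eqP => e; have := odd_cross sN dN' od; rewrite e; case: odd.
  + have orr : odd (csub (cross d s) s) by rewrite codd_sub // odd_cross //; case: odd.
    rewrite /circ_colour orr.
    have -> : (if odd s then csub s (cross d s) else csub (cross d s) s) = d.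
      rewrite /cross; case: (odd s); first exact: csubKC.
      exact: cadd_sub.
    rewrite dN; congr pair; rewrite /third.
    have := cycle_tint_lt3 d.-1 (even_end d s).
    have := cycle_tint_lt3 d.-1 (csub (even_end d s) d.-1).
    have := cycle_tint_sub e0 eN s0N; move: h1 h2.
    by move: (cycle_tint _ _) (cycle_tint _ _) => x y; lia.
- have dN' : d < N by lia.
  have tN := cross_lt sN dN'.
  rewrite /= -!/(cross d _); split=> //.
  + exact: crossK.
  + by apply/eqP => e; have := odd_cross sN dN' od; rewrite e; case: odd.
  have orr : odd (csub (cross d s) s) by rewrite codd_sub // odd_cross //; case: odd.
  rewrite /circ_colour orr.
  have -> : (if odd s then csub s (cross d s) else csub (cross d s) s) = d.
    rewrite /cross; case: (odd s); first exact: csubKC.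
    exact: cadd_sub.
  by rewrite ifF //; lia.
- have mN : N./2 < N by lia.
  have tN := cadd_lt sN mN.
  rewrite /=; split=> //.
  + by have [] := caddE sN mN; have [] := caddE tN mN; lia.
  + by have [_] := caddE sN mN; lia.
  have r := cadd_sub sN mN.
  by rewrite /circ_colour r (negbTE oN) ifF ?ifT //; lia.
Qed.

Definition near r := r \in [:: 0; 1; 2; 3; N - 3; N - 2; N - 1].

Lemma circ_colour_spec s t : s < N -> t < N -> ~~ near (csub t s) ->
  valid_colour (circ_colour s t) /\ circ_factor (circ_colour s t) s = t.
Proof.
move=> sN tN; have rN := csub_lt tN sN.
have tE : t = cadd s (csub t s) by rewrite -{1}(csubK tN sN) /cadd addnC.
have sE : csub s t = N - csub t s \/ csub t s = 0.
  by have [_] := csubE tN sN; have [] := csubE sN tN; lia.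
rewrite /near !inE /circ_colour; move: tE sE; set r := csub t s in rN * => tE sE nr.
case: ifP => or.
  have dE : (if odd s then csub s t else r) < N by case: ifP => // _; apply: csub_lt.
  have oR : odd (if odd s then csub s t else r) by case: ifP => // _; lia.
  have cE : cross (if odd s then csub s t else r) s = t.
    by rewrite /cross; case: (odd s); [exact: csubKC | rewrite -tE].
  have nd : let d := if odd s then csub s t else r in 5 <= d /\ d + 5 <= N.
    by rewrite /=; case: (odd s); lia.
  move: dE oR cE nd; move: (if odd s then csub s t else r) => d dN od cE /= [d5 d5'].
  case: ifP => dd; last by rewrite /= -/(cross d s) cE; split=> //; lia.
  have e0 : 0 < d.-1 by lia.
  have eN : d.-1.*2 < N by lia.
  have s0N := even_end_lt sN dN.
  have x3 := cycle_tint_lt3 d.-1 (even_end d s).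
  have y3 := cycle_tint_lt3 d.-1 (csub (even_end d s) d.-1).
  have xy := cycle_tint_sub e0 eN s0N.
  have z3 : third (cycle_tint d.-1 (even_end d s)) (cycle_tint d.-1 (csub (even_end d s) d.-1)) < 3.
    by rewrite /third; lia.
  split; first by rewrite /= z3 od d5 dd.
  rewrite circ_factor_prism // /third ifF ?ifF //; lia.
case: ifP => r2.
  split; first by rewrite /= cycle_tint_lt3; lia.
  by rewrite circ_factor_prism ?cycle_tint_lt3 //= eqxx -tE.
case: ifP => rm.
  have rE : r = N./2 by lia.
  split; first by rewrite /= -rE; lia.
  by rewrite /= -rE -tE.
have [e eE] : exists e, e = N - r by exists (N - r).
rewrite -eE /=.
have e0 : 0 < e by lia.
have e4 : 3 < e by lia.
have eN : e.*2 < N by lia.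
have eN' : e < N by lia.
have ee : ~~ odd e by lia.
have s0N : even_end e.+1 s < N by apply: even_end_lt => //; lia.
have tE' : csub s e = t.
  rewrite tE; have [] := caddE sN rN; have [] := csubE sN eN'.
  move: (csub s e) (cadd s r) => p q; clearbody r; lia.
split; first by rewrite cycle_tint_lt3; lia.
rewrite -/(circ_factor (_, _) _) circ_factor_prism ?cycle_tint_lt3 //= eqxx tE'.
by have := cycle_tint_sub e0 eN s0N; rewrite eq_sym => /negbTE ->.
Qed.

Lemma valid_colour_bound c : valid_colour c -> c.1 < N /\ c.2 < 5.
Proof. by case: c => d i /=; lia. Qed.

Lemma near_uncoloured s t : s < N -> t < N -> near (csub t s) -> ~~ valid_colour (circ_colour s t).
Proof.
move=> sN tN; rewrite /near !inE => nr.
have sE : csub s t + csub t s = N \/ csub t s = 0.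
  by have [_] := csubE tN sN; have [] := csubE sN tN; lia.
rewrite /circ_colour; move: nr sE; move: (csub t s) (csub s t) => r q nr sE.
case: ifP => or.
  case: ifP => _; last by rewrite /=; case: (odd s); lia.
  have : third (cycle_tint (if odd s then q else r).-1 (even_end (if odd s then q else r) s))
     (cycle_tint (if odd s then q else r).-1 (csub (even_end (if odd s then q else r) s)
        (if odd s then q else r).-1)) < 4 by rewrite /third; lia.
  move: (third _ _) => i; rewrite /=; case: (odd s); lia.
case: ifP => r2; first by have := cycle_tint_lt3 r (even_end r.+1 s); rewrite /=; lia.
case: ifP => rm; first by rewrite /=; lia.
have := cycle_tint_lt3 (N - r) (csub (even_end (N - r).+1 s) (N - r)).
by rewrite /=; move: (cycle_tint _ _) => i; lia.
Qed.

(** [s + turn k r] completes [s] and [s + r] to a triple {i, i + 1, i + 3} in the first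
    system and {i, i + 2, i + 3} in the second. Each kind covers the differences 1, 2 and
    3 once. *)
Definition turn (k : bool) r :=
  if r < 4 then nth 0 (if k then [:: 0; 3; N - 1; 1] else [:: 0; N - 2; 3; 2]) r
  else nth 0 (if k then [:: 0; 2; N - 3; N - 2] else [:: 0; N - 3; 1; N - 1]) (N - r).

Definition circ_triple k s t := cadd s (turn k (csub t s)).

Lemma near_cases r : r < N -> near r ->
  [\/ r = 0, [\/ r = 1, r = 2 | r = 3] | [\/ r = N - 3, r = N - 2 | r = N - 1]].
Proof.
move=> rN; rewrite /near !inE => h.
have : r = 0 \/ r = 1 \/ r = 2 \/ r = 3 \/ r = N - 3 \/ r = N - 2 \/ r = N - 1 by lia.
by case=> [| [| [| [| [| [|]]]]]] ->; [constructor 1 | constructor 2; constructor 1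
  | constructor 2; constructor 2 | constructor 2; constructor 3 | constructor 3; constructor 1
  | constructor 3; constructor 2 | constructor 3; constructor 3].
Qed.

Lemma turn_values k : [/\ turn k 0 = 0,
  [/\ turn k 1 = if k then 3 else N - 2, turn k 2 = (if k then N - 1 else 3)
    & turn k 3 = if k then 1 else 2]
  & [/\ turn k (N - 3) = if k then N - 2 else N - 1,
       turn k (N - 2) = (if k then N - 3 else 1)
     & turn k (N - 1) = if k then 2 else N - 3]].
Proof.
have h i : 0 < i -> i < 4 -> (N - i < 4) = false /\ N - (N - i) = i by lia.
by rewrite /turn; case: k; split=> //; split=> //;
  [have [-> ->] := h 3 isT isT | have [-> ->] := h 2 isT isT | have [-> ->] := h 1 isT isT
  |have [-> ->] := h 3 isT isT | have [-> ->] := h 2 isT isT | have [-> ->] := h 1 isT isT].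
Qed.

Lemma turn_near k r : r < N -> near r -> turn k r < N /\ near (turn k r).
Proof.
move=> rN nr; have [h0 [h1 h2 h3] [h4 h5 h6]] := turn_values k.
by case: (near_cases rN nr) => [-> | [] -> | [] ->]; rewrite ?h0 ?h1 ?h2 ?h3 ?h4 ?h5 ?h6;
  rewrite /near !inE; case: (k); lia.
Qed.

Lemma circ_triple_spec k s t : s < N -> t < N -> near (csub t s) ->
  [/\ circ_triple k s t < N, circ_triple k s t = circ_triple k t s,
      near (csub (circ_triple k s t) s) & circ_triple k s (circ_triple k s t) = t].
Proof.
move=> sN tN nr; have rN := csub_lt tN sN; have [hN hn] := turn_near k rN nr.
have sE : csub s t + csub t s = N \/ csub t s = 0 /\ csub s t = 0.
  by have [_] := csubE tN sN; have [] := csubE sN tN; lia.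
have tE : t = cadd s (csub t s).
  by have [] := csubE tN sN; have [] := caddE sN rN; lia.
have [h0 [h1 h2 h3] [h4 h5 h6]] := turn_values k.
split; first exact: cadd_lt.
- have qN := csub_lt sN tN; rewrite /circ_triple.
  move: sE tE hN hn rN nr qN; move: (csub t s) (csub s t) => r q sE tE hN hn rN nr qN.
  have gen a c : a < N -> c < N -> turn k r = a -> turn k q = c ->
      a = r + c \/ a + N = r + c \/ a = r + c + N \/ a + N + N = r + c ->
      cadd s (turn k r) = cadd t (turn k q).
    move=> aN cN -> ->; have [] := caddE sN aN; have [] := caddE tN cN.
    by have [] := caddE sN rN; rewrite -tE; lia.
  have q0 : r = 0 -> q = 0 by lia.
  have q1 i : 0 < i -> r = i -> q = N - i by lia.
  have NN i : 0 < i -> i < N -> N - (N - i) = i by lia.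
  case: (near_cases rN nr) => [rE | [] rE | [] rE].
  + by apply: (gen 0 0); rewrite ?(q0 rE) ?rE ?h0 //; lia.
  + apply: (gen (if k then 3 else N - 2) _ _ _ (etrans (congr1 _ rE) h1)
      (etrans (congr1 _ (q1 1 isT rE)) h6)); case: (k); lia.
  + apply: (gen (if k then N - 1 else 3) _ _ _ (etrans (congr1 _ rE) h2)
      (etrans (congr1 _ (q1 2 isT rE)) h5)); case: (k); lia.
  + apply: (gen (if k then 1 else 2) _ _ _ (etrans (congr1 _ rE) h3)
      (etrans (congr1 _ (q1 3 isT rE)) h4)); case: (k); lia.
  + have qE : q = 3 by lia.
    apply: (gen (if k then N - 2 else N - 1) _ _ _ (etrans (congr1 _ rE) h4)
      (etrans (congr1 _ qE) h3)); case: (k); lia.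
  + have qE : q = 2 by lia.
    apply: (gen (if k then N - 3 else 1) _ _ _ (etrans (congr1 _ rE) h5)
      (etrans (congr1 _ qE) h2)); case: (k); lia.
  + have qE : q = 1 by lia.
    apply: (gen (if k then 2 else N - 3) _ _ _ (etrans (congr1 _ rE) h6)
      (etrans (congr1 _ qE) h1)); case: (k); lia.
- by rewrite cadd_sub.
- rewrite {1}/circ_triple.
  have -> : csub (circ_triple k s t) s = turn k (csub t s) by rewrite cadd_sub.
  rewrite [RHS]tE; congr cadd.
  by case: (near_cases rN nr) => [-> | [] -> | [] ->]; rewrite ?h0 ?h1 ?h2 ?h3 ?h4 ?h5 ?h6;
    case: (k) h0 h1 h2 h3 h4 h5 h6 => h0 h1 h2 h3 h4 h5 h6; rewrite ?h0 ?h1 ?h2 ?h3 ?h4 ?h5 ?h6.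
Qed.

(** These two edges of one matching are placed so that, with a common third point in [V],
    they form a Pasch configuration together with the triples {6, 7, 9} and {6, 3, 4} of
    the first system. *)
Lemma twin_edges : circ_colour 3 7 = (5, 2) /\ circ_factor (5, 2) 4 = 9.
Proof.
have e1 : even_end 5 3 = N - 2 by rewrite /even_end /csub /=; lia.
have e2 : cycle_tint 4 (N - 2) = 2 by rewrite /cycle_tint ifT //; lia.
have e3 : cycle_tint 4 4 = 1 by rewrite /cycle_tint ifF //; lia.
have e4 : cycle_tint 4 0 = 0 by rewrite /cycle_tint ifF //; lia.
split; first by rewrite /circ_colour (_ : csub 7 3 = 4) //= ifT ?e1 ?e2 //; lia.
rewrite circ_factor_prism // (_ : even_end 5 4 = 4) //= e3 /= (_ : csub 4 4 = 0) // e4 /=.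
by rewrite /cross /cadd /= ifT //; lia.
Qed.
End Circulant.

Section CirculantFactors.
Variable n : nat.
Local Notation N := n.+1.
Hypothesis N_even : ~~ odd N.
Hypothesis N_big : 38 <= N.

Definition shade : predArgType :=
  {c : 'I_N * 'I_5 | valid_colour N (nat_of_ord c.1, nat_of_ord c.2)}.
Definition shade_code (c : shade) : nat * nat := (nat_of_ord (val c).1, nat_of_ord (val c).2).
Definition ord_factor (c : shade) (s : 'I_N) : 'I_N := inord (circ_factor N (shade_code c) s).
Definition ord_triple k (s t : 'I_N) : 'I_N := inord (circ_triple N k s t).

Lemma shade_valid c : valid_colour N (shade_code c).
Proof. exact: (valP c). Qed.

Lemma val_ord_factor c s : ord_factor c s = circ_factor N (shade_code c) s :> nat.
Proof.
by rewrite inordK //; have [] := circ_factor_spec N_even N_big (shade_valid c) (ltn_ord s).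
Qed.

Lemma shade_code_inj : injective shade_code.
Proof.
move=> c d [e1 e2]; apply: val_inj; rewrite [val c]surjective_pairing [val d]surjective_pairing.
by congr pair; apply: val_inj.
Qed.

Lemma ord_factor_factors : factors ord_factor.
Proof.
have spec c (s : 'I_N) := circ_factor_spec N_even N_big (shade_valid c) (ltn_ord s).
split=> [c s | c s | c c' s e].
- by apply: val_inj; rewrite /= !val_ord_factor; case: (spec c s).
- by rewrite -val_eqE /= val_ord_factor; case: (spec c s).
apply: shade_code_inj; have [_ _ _ <-] := spec c s; have [_ _ _ <-] := spec c' s.
by rewrite -!val_ord_factor e.
Qed.

Lemma ord_factor_ex (s t : 'I_N) : ~~ near N (csub N t s) ->
  exists2 c, shade_code c = circ_colour N s t & ord_factor c s = t.
Proof.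
move=> nr; have [v e] := circ_colour_spec N_even N_big (ltn_ord s) (ltn_ord t) nr.
have [d5 i5] := valid_colour_bound N_even N_big v.
pose c : 'I_N * 'I_5 := (inord (circ_colour N s t).1, inord (circ_colour N s t).2).
have vc : valid_colour N (nat_of_ord c.1, nat_of_ord c.2).
  by rewrite !inordK // -surjective_pairing.
have cE : shade_code (Sub c vc) = circ_colour N s t.
  by rewrite /shade_code /= !inordK // -surjective_pairing.
by eexists; [exact: cE | apply: val_inj; rewrite /= val_ord_factor cE].
Qed.

Lemma label_near (s t : 'I_N) : (label ord_factor s t == None) = near N (csub N t s).
Proof.
case nr: (near N (csub N t s)).
  case e: (label ord_factor s t) => [c|] //; have es := labelP e.
  have [_ _ _ h] := circ_factor_spec N_even N_big (shade_valid c) (ltn_ord s).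
  have := near_uncoloured N_even N_big (ltn_ord s) (ltn_ord t) nr.
  by rewrite -es val_ord_factor h shade_valid.
have [c _ <-] := ord_factor_ex (negbT nr).
by rewrite (label_fac ord_factor_factors).
Qed.

Lemma val_ord_triple k (s t : 'I_N) : near N (csub N t s) ->
  ord_triple k s t = circ_triple N k s t :> nat.
Proof.
move=> nr; rewrite inordK //.
by have [] := circ_triple_spec N_even N_big k (ltn_ord s) (ltn_ord t) nr.
Qed.

Lemma near_self (s : 'I_N) : near N (csub N s s).
Proof. by rewrite /near /csub leqnn subnn !inE. Qed.

Lemma ord_triple_remainder k : remainder ord_factor (ord_triple k).
Proof.
have nearE (s t : 'I_N) : label ord_factor s t = None -> near N (csub N t s).
  by move=> e; rewrite -label_near e.
have sub_near (s t : 'I_N) : label ord_factor s t = None -> near N (csub N s t).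
  by move=> e; rewrite -label_near (labelC ord_factor_factors) e.
have spec (s t : 'I_N) (e : label ord_factor s t = None) :=
  circ_triple_spec N_even N_big k (ltn_ord s) (ltn_ord t) (nearE _ _ e).
split=> [s | s t e | s t e | s t e].
- apply: val_inj; rewrite /= val_ord_triple ?near_self //.
  have s0 : csub N s s = 0 by rewrite /csub leqnn subnn.
  rewrite /circ_triple s0; have [-> _ _] := turn_values N_even N_big k.
  by rewrite /cadd addn0 ltn_ord.
- have [_ h _ _] := spec s t e.
  apply: val_inj => /=.
  by rewrite (val_ord_triple k (nearE _ _ e)) (val_ord_triple k (sub_near _ _ e)).
- have [_ _ h _] := spec s t e.
  by apply/eqP; rewrite label_near (val_ord_triple k (nearE _ _ e)).
- have [_ _ h1 h2] := spec s t e; have e1 := val_ord_triple k (nearE _ _ e).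
  by apply: val_inj; rewrite /= val_ord_triple e1.
Qed.

Lemma ord_triple_disjoint s t : s != t -> label ord_factor s t = None ->
  ord_triple true s t != ord_triple false s t.
Proof.
move=> st e; have nr : near N (csub N t s) by rewrite -label_near e.
have rN := csub_lt N_even N_big (ltn_ord t) (ltn_ord s).
have r0 : csub N t s != 0.
  have sN := ltn_ord s; have [_] := csubE N_even N_big (ltn_ord t) sN.
  by move: st; rewrite -val_eqE /=; lia.
rewrite -val_eqE /= !val_ord_triple // /circ_triple.
have [_ [a1 a2 a3] [a4 a5 a6]] := turn_values N_even N_big true.
have [_ [b1 b2 b3] [b4 b5 b6]] := turn_values N_even N_big false.
have gen r a b : turn N true r = a -> turn N false r = b -> a < N -> b < N ->
    a != b -> cadd N s (turn N true r) != cadd N s (turn N false r).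
  move=> -> -> aN bN ab; have [] := caddE N_even N_big (ltn_ord s) aN.
  by have [] := caddE N_even N_big (ltn_ord s) bN; lia.
case: (near_cases N_even N_big rN nr) => [rE | [] rE | [] rE]; first by rewrite rE in r0.
all: rewrite rE.
- by apply: (gen _ _ _ a1 b1); lia.
- by apply: (gen _ _ _ a2 b2); lia.
- by apply: (gen _ _ _ a3 b3); lia.
- by apply: (gen _ _ _ a4 b4); lia.
- by apply: (gen _ _ _ a5 b5); lia.
- by apply: (gen _ _ _ a6 b6); lia.
Qed.

(** The matchings join the point 0 to each point that is not near it exactly once. *)
Lemma card_shade : #|shade| = N - 7.
Proof.
pose s0 : 'I_N := ord0.
have -> : #|shade| = #|[set ord_factor c s0 | c : shade]|.
  by rewrite card_imset // => c d; apply: (fac_inj ord_factor_factors).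
pose l : seq 'I_N := [seq inord i | i <- [:: 0; 1; 2; 3; N - 3; N - 2; N - 1]].
have ul : uniq l.
  rewrite map_inj_in_uniq; first by rewrite /= !inE; lia.
  move=> i j iL jL e; have := congr1 val e; rewrite /= !inordK //.
    by move: jL; rewrite !inE; lia.
  by move: iL; rewrite !inE; lia.
have -> : [set ord_factor c s0 | c : shade] = ~: [set t in l].
  apply/setP => t; rewrite in_setC in_set.
  have -> : (t \in l) = near N (csub N t s0).
    have -> : csub N t s0 = t by rewrite /csub /= subn0.
    rewrite /near; apply/mapP/idP => [[i iL ->] | tL].
      by rewrite inordK //; move: iL; rewrite !inE; lia.
    by exists (nat_of_ord t); rewrite ?inord_val.
  rewrite -label_near; apply/imsetP/idP => [[c _ ->] | ].
    by rewrite (label_fac ord_factor_factors).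
  rewrite label_near => /ord_factor_ex [c _ <-].
  by exists c.
have := cardsC [set t in l]; rewrite card_ord cardsE (card_uniqP ul) /l size_map /=.
by lia.
Qed.
End CirculantFactors.

Section TriangleLink.
Variable n : nat.
Local Notation N := n.+1.
Hypothesis N_even : ~~ odd N.
Hypothesis N_big : 38 <= N.

(** The pair {s, s+1} lies in the first triple {s, s+1, s+3}, then {s, s+3} in the second
    triple {s, s+2, s+3}, and {s, s+2} in the first triple {s-1, s, s+2}: so all near
    pairs starting at [s] are linked, and so is {s-1, s}. *)
Lemma ord_triple_link (R : 'I_N -> 'I_N -> Prop) (s0 : 'I_N) :
  (forall s t, R s t -> R t s) ->
  (forall k (s t : 'I_N), near N (csub N t s) -> R s t -> R s (ord_triple k s t)) ->
  R s0 (inord (cadd N s0 1)) ->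
  forall s t : 'I_N, s != t -> near N (csub N t s) -> R s t.
Proof.
move=> RC Rtri R0.
pose P (s : 'I_N) r := R s (inord (cadd N s r)).
have [_ [a1 a2 a3] [a4 a5 a6]] := turn_values N_even N_big true.
have [_ [b1 b2 b3] [b4 b5 b6]] := turn_values N_even N_big false.
have turnP k s r : r < N -> near N r -> P s r -> P s (turn N k r).
  move=> rN nr; have sN := ltn_ord s; have tN := cadd_lt N_even N_big sN rN.
  have e : csub N (inord (cadd N s r) : 'I_N) s = r by rewrite inordK // cadd_sub.
  by rewrite /P => /(Rtri k); rewrite e /ord_triple /circ_triple e => /(_ nr).
have n1 : near N 1 by rewrite /near !inE.
have n2 : near N 2 by rewrite /near !inE.
have n3 : near N 3 by rewrite /near !inE.
have P3 s : P s 1 -> P s 3.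
  by move=> h; rewrite -a1; apply: turnP => //; lia.
have P2 s : P s 1 -> P s 2.
  by move=> /P3 h; rewrite -b3; apply: turnP => //; lia.
have down (s t : 'I_N) : t = csub N s 1 :> nat -> P s 1 -> P t 1.
  move=> tE /P2 h; have : P s (N - 1) by rewrite -a2; apply: turnP => //; lia.
  rewrite /P => /RC; have sN := ltn_ord s.
  have one : 1 < N by lia.
  have l1 : N - 1 < N by lia.
  have -> : inord (cadd N s (N - 1)) = t.
    apply: val_inj; rewrite /= tE inordK; last exact: cadd_lt.
    by have [] := caddE N_even N_big sN l1; have [] := csubE N_even N_big sN one; lia.
  have -> // : inord (cadd N t 1) = s.
  by apply: val_inj; rewrite /= tE csubK // inordK.
have all1 s : P s 1.
  have it m (t : 'I_N) : m < N -> t = csub N s0 m :> nat -> P t 1.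
    elim: m t => [|m IH] t mN tE.
      by rewrite (_ : t = s0) //; apply: val_inj; rewrite /= tE /csub subn0.
    have m1 : m < N by lia.
    have sN := ltn_ord s0; have one : 1 < N by lia.
    apply: (down (inord (csub N s0 m))); last by apply: IH => //; rewrite inordK // csub_lt.
    rewrite tE inordK ?csub_lt //.
    have [h1 h2] := csubE N_even N_big sN mN; have [h3 h4] := csubE N_even N_big sN m1.
    by have [] := csubE N_even N_big h3 one; lia.
  apply: (it (csub N s0 s)); first exact: csub_lt.
  by rewrite csubKC.
have pos (s t : 'I_N) : csub N t s = 1 \/ csub N t s = 2 \/ csub N t s = 3 -> R s t.
  have tE : inord (cadd N s (csub N t s)) = t.
    have tN := ltn_ord t; have sN := ltn_ord s; have rN := csub_lt N_even N_big tN sN.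
    apply: val_inj; rewrite /= inordK; last exact: cadd_lt.
    by have [] := caddE N_even N_big sN rN; have [] := csubE N_even N_big tN sN; lia.
  case=> [e | [e | e]]; rewrite -tE e; [exact: all1 | exact/P2/all1 | exact/P3/all1].
move=> s t st nr; have tN := ltn_ord t; have sN := ltn_ord s.
have rN := csub_lt N_even N_big tN sN.
have h1 := csubE N_even N_big tN sN; have h2 := csubE N_even N_big sN tN.
have st' : s != t :> nat by [].
case: (near_cases N_even N_big rN nr) => [rE | [] rE | [] rE]; first by lia.
- by apply: pos; lia.
- by apply: pos; lia.
- by apply: pos; lia.
- by apply/RC/pos; lia.
- by apply/RC/pos; lia.
- by apply/RC/pos; lia.
Qed.
End TriangleLink.

(** * Order 2u + 7 *)

Lemma joinedC (V W : finType) (f : V -> W -> W) T s t :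
  steiner T -> joined f T s t -> joined f T t s.
Proof.
move=> st; rewrite /joined (opC st).
case=> [h | [w e h]]; [by left | right; exists w => //].
by case: h => h; [right | left].
Qed.

Section Double7.
Variables (u : nat).
Hypothesis u_odd : odd u.
Hypothesis u_big : 30 < u.
Let n := u + 6.
Local Notation N := n.+1.

Let N_even : ~~ odd N. Proof. by rewrite /n; lia. Qed.
Let N_big : 38 <= N. Proof. by rewrite /n; lia. Qed.

(** The points are chosen opaquely so that they do not unfold during the case analyses. *)
Lemma point_family : {q : nat -> 'I_N | forall i, i < 16 -> q i = i :> nat}.
Proof. by exists (fun i => inord i) => i h; rewrite inordK //; have := N_big; lia. Qed.

Definition pt : nat -> 'I_N := sval point_family.

Lemma val_pt i : i < 16 -> pt i = i :> nat.
Proof. exact: (svalP point_family). Qed.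

Lemma near_pt i j : i < 16 -> j < 16 ->
  near N (csub N (pt j) (pt i)) = (j <= i + 3) && (i <= j + 3).
Proof.
move=> i16 j16; rewrite !val_pt // /near /csub !inE; have := N_big.
by case: ifP => h; lia.
Qed.

Lemma pt_inj i j : i < 16 -> j < 16 -> (pt i == pt j) = (i == j).
Proof. by move=> i16 j16; rewrite -val_eqE /= !val_pt. Qed.

(** The points touched by the two switches in [rich_double_plus7]. *)
Definition special := [:: 3; 4; 6; 7; 9; 15].
Definition bad := [seq pt i | i <- special].

Lemma badP s : s \in bad -> exists2 i, i \in special & s = pt i.
Proof. by move=> /mapP. Qed.

Lemma special_lt i : i \in special -> i < 16.
Proof. by rewrite !inE; lia. Qed.

Lemma gamma_ex : exists c, ord_factor (n := n) c (pt 3) = pt 7 /\ ord_factor c (pt 4) = pt 9.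
Proof.
have [|c cE e] := ord_factor_ex N_even N_big (s := pt 3) (t := pt 7); first by rewrite near_pt.
have [h1 h2] := twin_edges N_even N_big.
by exists c; split=> //; apply: val_inj; rewrite /= val_ord_factor // cE !val_pt // h1 h2.
Qed.

(** On [W], of size [u + 7], the circulant factorization supplies the [u] labels, and the
    near pairs are covered by triples that are linked to each other but to nothing else. A
    first Pasch switch replaces the blocks {6,7,9}, {6,3,4}, {g,3,7}, {g,4,9} by {6,7,3},
    {6,9,4}, {g,7,9}, {g,3,4}, where [g] is the label of the edges of [twin_edges]; the
    last two contain a near pair and a point of [V]. The second switch, of
    [glue_bidesign], uses the triangle 3, 9, 15, whose edges the first one leaves alone
    because 3 and 9 are opposite in it. *)
Lemma rich_double_plus7 : rich u -> rich (2 * u + 7).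
Proof.
move=> [V [S [phi [cV bdS car]]]].
have V22 : 22 < #|V| by rewrite cV; lia.
have [x [y [z [uV xyz nx]]]] := spare_block phi bdS V22.
pose W : finType := 'I_N; pose f := @ord_factor n.
have ff : factors f := ord_factor_factors N_even N_big.
pose p3 : W := pt 3; pose p4 : W := pt 4; pose p6 : W := pt 6.
pose p7 : W := pt 7; pose p9 : W := pt 9; pose p15 : W := pt 15.
have far i j : i < 16 -> j < 16 -> ~~ ((j <= i + 3) && (i <= j + 3)) ->
    exists c, f c (pt i) = pt j.
  move=> i16 j16 nij; have [|c _ e] := ord_factor_ex N_even N_big (s := pt i) (t := pt j).
    by rewrite near_pt.
  by exists c.
have uW : uniq [:: p3; p9; p15] by rewrite /= !inE !pt_inj.
have [c1 e1] : exists c, f c p3 = p9 by apply: far.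
have [c2 e2] : exists c, f c p3 = p15 by apply: far.
have [c3 e3] : exists c, f c p9 = p15 by apply: far.
have cVC : #|V| = #|shade n| by rewrite cV card_shade // /n; lia.
have [g [gb [gx gy gz]]] := relabel ff cVC uV uW e1 e2 e3.
pose fV v := f (g v).
have ffV : factors fV := factors_relabel ff gb.
have fx : fV x p3 = p9 by rewrite /fV gx.
have fy : fV y p3 = p15 by rewrite /fV gy.
have fz : fV z p9 = p15 by rewrite /fV gz.
have [gam [gam3 gam4]] : exists v, fV v p3 = p7 /\ fV v p4 = p9.
  have [c [h1 h2]] := gamma_ex; case: gb => h gh hg.
  by exists (h c); rewrite /fV hg.
have gam7 : fV gam p7 = p3 by rewrite -gam3 (facK ffV).
have gam9 : fV gam p9 = p4 by rewrite -gam4 (facK ffV).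
pose o := @ord_triple n.
have rem k : remainder fV (o k) := remainder_relabel gb (ord_triple_remainder N_even N_big k).
have labN (s t : W) : (label fV s t == None) = near N (csub N t s).
  by rewrite (label_relabel f gb) label_near.
have lab0 (s t : W) : label fV s t = None <-> near N (csub N t s).
  by rewrite -labN; split=> [-> // | /eqP].
have o_disj s t : s != t -> label fV s t = None -> o true s t != o false s t.
  by move=> st /lab0 h; apply: ord_triple_disjoint => //; apply/eqP; rewrite label_near.
(* The special points that are not near each other. These are eight pairs, hence at most
   eight labels for [p] to keep apart, and 16 <= u. *)
pose pairsF : seq (nat * nat) :=
  [:: (3, 7); (3, 9); (3, 15); (4, 9); (4, 15); (6, 15); (7, 15); (9, 15)].
pose B := undup (pmap (fun q => label fV (pt q.1) (pt q.2)) pairsF).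
have [p [pI pS p_cyc p_neq p_sep]] : exists p : V -> V, [/\ injective p,
    forall c, exists c', p c' = c,
    forall R : V -> Prop, (forall c, R (p c) -> R c) -> forall c d, R c -> R d,
    forall c, p c != c & forall c, c \in B -> p c \notin B].
  apply: cyclic_perm; [exact: undup_uniq | | by rewrite cV; lia].
  rewrite cV; apply: (@leq_trans 16); last by lia.
  rewrite (@leq_mul2l 2 _ 8) /=; apply: leq_trans (size_undup _) _.
  by rewrite size_pmap; apply: leq_trans (count_size _ _) _.
have bad_label s t c : s \in bad -> t \in bad -> fV c s = t -> c \in B.
  move=> /badP [i iS ->] /badP [j jS ->] e.
  have e' : fV c (pt j) = pt i by rewrite -e (facK ffV).
  have : ~~ near N (csub N (pt j) (pt i)) by rewrite -labN -e (label_fac ffV).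
  rewrite near_pt ?special_lt // mem_undup => nij.
  rewrite mem_pmap; apply/mapP.
  have : ((i, j) \in pairsF) || ((j, i) \in pairsF).
    have H : all (fun i => all (fun j => [|| (j <= i + 3) && (i <= j + 3),
        (i, j) \in pairsF | (j, i) \in pairsF]) special) special by [].
    by have /allP /(_ _ jS) := allP H _ iS; rewrite (negbTE nij).
  have lij : label fV (pt i) (pt j) = Some c by rewrite -e (label_fac ffV).
  have lji : label fV (pt j) (pt i) = Some c by rewrite -e' (label_fac ffV).
  case/orP => h; first by exists (i, j); [exact: h | exact: esym lij].
  by exists (j, i); [exact: h | exact: esym lji].
pose T1 := doubling (S true) fV (o true).
pose T2 := doubling (S false) (fun c => fV (p c)) (o false).
have st1 : steiner T1 := doubling_steiner (bd_steiner bdS true) ffV (rem true).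
have st2 : steiner T2 := steiner2 bdS ffV pS pI rem.
have disj : forall a b, a != b -> T1 a b != T2 a b.
  exact: (double_disjoint bdS ffV pS p_neq o_disj).
have nearT (s t : W) : near N (csub N t s) -> T1 (inr s) (inr t) = inr (o true s t).
  by move=> /lab0 e; rewrite /T1 /= e.
have nearT2 (s t : W) : near N (csub N t s) -> T2 (inr s) (inr t) = inr (o false s t).
  move=> /lab0 e; have := label_shift fV pS s t; rewrite e eqxx => /eqP e2'.
  by rewrite /T2 /= e2'.
have farT c (s t : W) : fV c s = t -> T1 (inr s) (inr t) = inl c.
  by move=> <-; rewrite /T1 /= (label_fac ffV).
pose sB : seq (V + W) := [:: inr p6; inr p7; inr p9; inr p3; inr p4; inl gam].
pose TB := switch T1 sB.
have [w0 [w1 w2 w3] [w4 w5 w6]] := turn_values N_even N_big true.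
have [v0 [v1 v2 v3] [v4 v5 v6]] := turn_values N_even N_big false.
have triE k i j r : i < 16 -> j < 16 -> near N (csub N (pt j) (pt i)) ->
    circ_triple N k i j = r -> r < 16 -> o k (pt i) (pt j) = pt r.
  move=> i16 j16 nij e r16; apply: val_inj; rewrite /= val_ord_triple // !val_pt //.
have o67 : o true p6 p7 = p9.
  by apply: triE; rewrite ?near_pt // /circ_triple (_ : csub N 7 6 = 1) // w1 /cadd ifT //; lia.
have o63 : o true p6 p3 = p4.
  apply: triE; rewrite ?near_pt // /circ_triple (_ : csub N 3 6 = N - 3);
    last by rewrite /csub /=; lia.
  by rewrite w4 /cadd ifF; lia.
have o67' : o false p6 p7 = p4.
  apply: triE; rewrite ?near_pt // /circ_triple (_ : csub N 7 6 = 1) // v1 /cadd ifF; lia.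
have psB : pasch T1 sB.
  split=> [||a] //.
    rewrite -[sB]/(rcons [seq inr w | w <- [:: p6; p7; p9; p3; p4]] (inl gam)) rcons_uniq.
    rewrite map_inj_uniq; last by move=> ? ? [].
    apply/andP; split; first by apply/mapP => -[].
    by rewrite /= !inE !pt_inj.
  split.
  - by rewrite -[LHS]/(T1 (inr p6) (inr p7)) nearT ?near_pt // o67.
  - by rewrite -[LHS]/(T1 (inr p6) (inr p3)) nearT ?near_pt // o63.
  - exact: (farT gam p7 p3).
  - exact: (farT gam p9 p4).
have stB : steiner TB := switch_steiner st1 psB.
have oF69 : o false p6 p9 = pt 8.
  apply: triE; rewrite ?near_pt // /circ_triple (_ : csub N 9 6 = 3) // v3 /cadd ifT; lia.
have TB_disj : forall a b, a != b -> TB a b != T2 a b.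
  apply: (switch_disjoint st1 psB (x0 := inl gam) st2 disj).
  - rewrite -[X in X != _]/(T2 (inr p6) (inr p7)) nearT2 ?near_pt // o67'.
    by apply/eqP => -[/eqP]; rewrite pt_inj.
  - rewrite -[X in X != _]/(T2 (inr p6) (inr p9)) nearT2 ?near_pt // oF69.
    by apply/eqP => -[/eqP]; rewrite pt_inj.
  - by rewrite -[X in X != _]/(T2 (inr p7) (inr p9)) nearT2 ?near_pt.
  - by rewrite -[X in X != _]/(T2 (inr p3) (inr p4)) nearT2 ?near_pt.
have in_inr (s : W) : (inr s \in sB) = (s \in [:: p6; p7; p9; p3; p4]) by [].
have in_inl a : (inl a \in sB) = (a == gam).
  by rewrite -[RHS]orbF.
have TB_old a b : TB (inl a) (inl b) = inl (S true a b).
  rewrite /TB /switch ifF //; apply/negP => /and4P [].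
  by rewrite !in_inl => /eqP -> /eqP ->; rewrite eqxx.
have badE (s : W) : s \in bad = (s \in [:: p3; p4; p6; p7; p9; p15]) by [].
have TB_good (s : W) a : s \notin bad -> TB (inr s) a = T1 (inr s) a.
  move=> sb; apply: switch_out; rewrite in_inr; apply: contra sb; rewrite badE !inE.
  by case/or4P => [-> | -> | -> | /orP [] ->]; rewrite ?orbT.
have [t67 t69 t79 t34] : [/\ TB (inr p6) (inr p7) = inr p3, TB (inr p6) (inr p9) = inr p4,
    TB (inr p7) (inr p9) = inl gam & TB (inr p3) (inr p4) = inl gam].
  exact: (switch_values st1 psB (inl gam)).
have t63 : TB (inr p6) (inr p3) = inr p7 by rewrite -t67 (opK stB).
have t64 : TB (inr p6) (inr p4) = inr p9 by rewrite -t69 (opK stB).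
have farL i j : i < 16 -> j < 16 -> ~~ ((j <= i + 3) && (i <= j + 3)) ->
    label fV (pt i) (pt j) != None.
  by move=> i16 j16 nij; rewrite labN near_pt.
have jC (s t : W) : joined fV TB s t -> joined fV TB t s := joinedC stB.
have j34 : joined fV TB p3 p4 by left; exists gam.
have j79 : joined fV TB p7 p9 by left; exists gam.
have j67 : joined fV TB p6 p7 by right; exists p3 => //; right; apply: farL.
have j69 : joined fV TB p6 p9 by right; exists p4 => //; right; apply: farL.
have j63 : joined fV TB p6 p3 by right; exists p7 => //; right; apply: farL.
have j64 : joined fV TB p6 p4 by right; exists p9 => //; right; apply: farL.
(* The near pair {4, 7} is untouched, its points being opposite. *)
have o4 : opp sB (inr p4) = inr p7 by exact: (opp_nth psB (inl gam) (i := 4)).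
have o7 : opp sB (inr p7) = inr p4 by exact: (opp_nth psB (inl gam) (i := 1)).
have TB_rem (s t : W) : label fV s t = None ->
    TB (inr s) (inr t) = inr (o true s t) \/ joined fV TB s t.
  move=> e; case cab: (collinear sB (inr s) (inr t)); last first.
    by left; rewrite /TB /switch cab nearT //; apply/lab0.
  right; case/and4P: cab; rewrite !in_inr => sI tI st no.
  have no47 : ~ (s = p4 /\ t = p7) by case=> e1' e2'; move: no; rewrite e1' e2' o4 eqxx.
  have no74 : ~ (s = p7 /\ t = p4) by case=> e1' e2'; move: no; rewrite e1' e2' o7 eqxx.
  have nF i j : i < 16 -> j < 16 -> ~~ ((j <= i + 3) && (i <= j + 3)) -> ~ (s = pt i /\ t = pt j).
    by move=> i16 j16 nij [e1' e2']; have := farL i j i16 j16 nij; rewrite -e1' -e2' e.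
  have n37 := nF 3 7 isT isT isT; have n73 := nF 7 3 isT isT isT.
  have n39 := nF 3 9 isT isT isT; have n93 := nF 9 3 isT isT isT.
  have n49 := nF 4 9 isT isT isT; have n94 := nF 9 4 isT isT isT.
  have st' : s <> t by move=> e'; move: st; rewrite e' eqxx.
  have mem5 r : r \in [:: p6; p7; p9; p3; p4] -> [\/ r = p6, r = p7 | [\/ r = p9, r = p3 | r = p4]].
    rewrite !in_cons in_nil orbF => /or4P [/eqP | /eqP | /eqP | /orP [] /eqP] ->;
    by [constructor 1 | constructor 2 | constructor 3; constructor 1
       | constructor 3; constructor 2 | constructor 3; constructor 3].
  case: (mem5 _ sI) => [es | es | [] es]; case: (mem5 _ tI) => [et | et | [] et].
  - by case: (st' (etrans es (esym et))).
  - by rewrite es et; exact: j67.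
  - by rewrite es et; exact: j69.
  - by rewrite es et; exact: j63.
  - by rewrite es et; exact: j64.
  - by rewrite es et; exact: jC j67.
  - by case: (st' (etrans es (esym et))).
  - by rewrite es et; exact: j79.
  - by case: (n73 (conj es et)).
  - by case: (no74 (conj es et)).
  - by rewrite es et; exact: jC j69.
  - by rewrite es et; exact: jC j79.
  - by case: (st' (etrans es (esym et))).
  - by case: (n93 (conj es et)).
  - by case: (n94 (conj es et)).
  - by rewrite es et; exact: jC j63.
  - by case: (n37 (conj es et)).
  - by case: (n39 (conj es et)).
  - by case: (st' (etrans es (esym et))).
  - by rewrite es et; exact: j34.
  - by rewrite es et; exact: jC j64.
  - by case: (no47 (conj es et)).
  - by case: (n49 (conj es et)).
  - by rewrite es et; exact: jC j34.
  - by case: (st' (etrans es (esym et))).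
have rem_link : forall R : W -> W -> Prop, (forall s t, R s t -> R t s) ->
    (forall k s t, label fV s t = None -> R s t -> R s (o k s t)) ->
    (forall s t, label fV s t = None -> joined fV TB s t -> R s t) ->
    forall s t, s != t -> label fV s t = None -> R s t.
  move=> R RC Ro Rj s t st /lab0 nst.
  apply: (ord_triple_link N_even N_big (s0 := p3) RC) => // [k s' t' n' | ].
    by apply: Ro; apply/lab0.
  have -> : inord (cadd N p3 1) = p4.
    by apply: val_inj; rewrite /= val_pt // inordK ?val_pt // /cadd ifT //; lia.
  by apply: Rj => //; apply/lab0; rewrite near_pt.
have good_path (s t : W) : s \notin bad -> t \notin bad ->
    exists2 r, r \notin bad & label fV s r != None /\ label fV r t != None.
  move=> sb tb.
  pose around (q : W) : seq W :=
    [seq inord (cadd N q r) | r <- [:: 0; 1; 2; 3; N - 3; N - 2; N - 1]].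
  have aroundP (q r : W) : near N (csub N r q) -> r \in around q.
    move=> nr; apply/mapP; exists (csub N r q); first exact: nr.
    have rN := ltn_ord r; have qN := ltn_ord q; have dN := csub_lt N_even N_big rN qN.
    apply: val_inj; rewrite /= inordK; last exact: cadd_lt.
    by have [] := caddE N_even N_big qN dN; have [] := csubE N_even N_big rN qN; lia.
  have [r] : exists r, r \notin bad ++ around s ++ around t.
    apply: avoid; rewrite !size_cat !size_map card_ord /=; lia.
  rewrite (mem_cat r bad) (mem_cat r (around s)) negb_or => /andP [rb].
  rewrite negb_or => /andP [rs rt]; exists r; first exact: rb.
  split; first by rewrite labN; apply: contra rs; apply: aroundP.
  by rewrite (labelC ffV) labN; apply: contra rt; apply: aroundP.
have bad_good (s : W) c : s \in bad -> fV c s \notin bad \/ fV (p c) s \notin bad.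
  move=> sb; case b1: (fV c s \in bad); last by left.
  right; apply/negP => b2; have := p_sep c (bad_label _ _ _ sb b1 erefl).
  by rewrite (bad_label _ _ _ sb b2 erefl).
have [s0 s0N] : exists s0, s0 \notin bad.
  by apply: avoid; rewrite size_map card_ord; have := N_big; rewrite /=; lia.
have xy : x != y by move: uV; rewrite /= !inE negb_or -andbA => /and3P [].
have gam_out c i j : i < 16 -> j < 16 -> fV c (pt i) = pt j ->
    ~~ [|| (i == 3) && (j == 7), (i == 7) && (j == 3), (i == 4) && (j == 9)
         | (i == 9) && (j == 4)] ->
    i \in [:: 3; 4; 7; 9] -> c != gam.
  move=> i16 j16 e nij i4; apply/eqP => ec; move: e; rewrite ec; move: i4 nij {i16}.
  by rewrite !inE => /or4P [] /eqP -> /= nij; rewrite ?gam3 ?gam4 ?gam7 ?gam9 => /eqP;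
    rewrite pt_inj // eq_sym; move: nij; case: eqP.
have TB_cross c i j : fV c (pt i) = pt j -> c != gam -> TB (inl c) (inr (pt i)) = inr (pt j).
  by move=> e cg; rewrite /TB switch_out ?in_inl // /T1 /= e.
have xPQ : TB (inl x) (inr p3) = inr p9.
  by apply: TB_cross => //; apply: (gam_out x 3 9).
have yPR : TB (inl y) (inr p3) = inr p15.
  by apply: TB_cross => //; apply: (gam_out y 3 15).
have zQR : TB (inl z) (inr p9) = inr p15.
  by apply: TB_cross => //; apply: (gam_out z 9 15).
have cW : #|W| = u + 7 by rewrite card_ord /n; lia.
pose TT := switch TB [:: inl x; inl y; inl z; inr p3; inr p9; inr p15].
exists (V + W)%type, (fun k => if k then TT else T2), (inl \o phi).
split; first by rewrite card_sum cV cW; lia.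
  apply: (@glue_bidesign V W S fV p o bdS ffV pS pI p_cyc rem TB bad stB TB_disj TB_old
    TB_good TB_rem rem_link good_path bad_good s0 s0N x y z p3 p9 p15 xy xyz uW) => //.
  - by move=> s; rewrite badE !inE => /or3P [] ->; rewrite ?orbT.
  - move=> s t; rewrite !in_cons !in_nil !orbF => /or3P [] /eqP -> /or3P [] /eqP -> st;
      first [ by rewrite eqxx in st | exact: farL ].
by apply: (@glue_carries V W S fV p o bdS TB stB TB_old x y z p3 p9 p15).
Qed.
End Double7.

(** * All admissible orders *)

Lemma rich_small v : admissible v -> 31 <= v < 63 -> rich v.
Proof.
rewrite /admissible => va vb.
have : v \in [:: 31; 33; 37; 39; 43; 45; 49; 51; 55; 57; 61] by rewrite !inE; lia.
rewrite !inE => /orP [/eqP -> | ]; first exact: certified_rich certified_31.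
move=> /orP [/eqP -> | ]; first exact: certified_rich certified_33.
move=> /orP [/eqP -> | ]; first exact: certified_rich certified_37.
move=> /orP [/eqP -> | ]; first exact: certified_rich certified_39.
move=> /orP [/eqP -> | ]; first exact: certified_rich certified_43.
move=> /orP [/eqP -> | ]; first exact: certified_rich certified_45.
move=> /orP [/eqP -> | ]; first exact: certified_rich certified_49.
move=> /orP [/eqP -> | ]; first exact: certified_rich certified_51.
move=> /orP [/eqP -> | ]; first exact: certified_rich certified_55.
move=> /orP [/eqP -> | /eqP ->]; first exact: certified_rich certified_57.
exact: certified_rich certified_61.
Qed.

(** An admissible [v] is [2 u + 1] with admissible [u] when it is 3 or 7 modulo 12, and [2
    u + 7] when it is 1 or 9; from 63 on, [u >= 31]. *)
Lemma rich_admissible v : admissible v -> 31 <= v -> rich v.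
Proof.
elim/ltn_ind: v => v IH va v31.
case: (ltnP v 63) => v63; first by apply: rich_small; rewrite // v31.
have [u [ua ub ue]] : exists u, [/\ admissible u, 31 <= u < v & v = 2 * u + 1 \/ v = 2 * u + 7].
  move: va; rewrite /admissible => va.
  case: (boolP ((v %% 12 == 3) || (v %% 12 == 7))) => m.
    by exists ((v - 1) %/ 2); split; lia.
  by exists ((v - 7) %/ 2); split; lia.
have /andP [u31 uv] := ub; have ru := IH u uv ua u31.
have uo : odd u by move: ua; rewrite /admissible; lia.
by case: ue => ->; [apply: rich_double => //; lia | apply: rich_double_plus7].
Qed.

Theorem theorem1p3 (u v : nat) :
  admissible u -> admissible v -> 2 * u < v -> 13 < u ->
  (exists D : TTS u,
     [/\ bipartite (two_BIG D), connected (two_BIG D)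
       & ~ hamiltonian (two_BIG D)]) ->
  (exists D : TTS v,
     [/\ bipartite (two_BIG D), connected (two_BIG D)
       & ~ hamiltonian (two_BIG D)]).
Proof.
move=> ua va uv u13 _; apply: rich_TTS; first by lia.
by apply: rich_admissible => //; move: ua va; rewrite /admissible; lia.
Qed.
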